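(* Let $k\ge 1$ and $d\ge 1$ be integers and let $\sigma\in S_k$. Then: (a) The function $M_{\sigma,d}$ on $\coprod_{n\ge 1}S_n$ is a polynomial in $n, m_1,m_2,\ldots,m_{dk}$ of degree at most $dk$, where $n$ has degree $1$ and $m_i$ has degree $i$. That is, there is a single polynomial $f_{\sigma,d}\in\mathbb{Q}[y,x_1,\ldots,x_{dk}]$ (depending only on $\sigma$ and $d$), of weighted degree at most $dk$ where $y$ has degree $1$ and $x_i$ has degree $i$, such that for all $n\ge 1$ and all $\pi\in S_n$, $$M_{\sigma,d,n}(\pi)=f_{\sigma,d}\bigl(n,m_1(\pi),m_2(\pi),\ldots,m_{dk}(\pi)\bigr).$$ (b) There is a family of polynomials $a^{\lambda}_{\sigma,d}\in\mathbb{Q}[n]$, indexed by the integer partitions $\lambda$ (including the empty partition) with $|\lambda|\le dk$, where $a^\lambda_{\sigma,d}$ has degree at most $dk-|\lambda|$, such that for all $n\ge 2dk$ there is an equality of class functions on $S_n$ $$M_{\sigma,d,n}=\sum_{|\lambda|\le dk}a^{\lambda}_{\sigma,d}(n)\,\chi^{\lambda[n]}.$$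
   Context: For $\sigma=\sigma_1\cdots\sigma_k\in S_k$ and $\pi=\pi_1\cdots\pi_n\in S_n$ (one-line notation), an occurrence of $\sigma$ in $\pi$ is a tuple of indices $1\le i_1<\cdots<i_k\le n$ such that for all $a,b$, $\pi_{i_a}<\pi_{i_b}$ if and only if $\sigma_a<\sigma_b$. $N_\sigma(\pi)$ denotes the number of occurrences of $\sigma$ in $\pi$. For positive integers $d,n$, the class function $M_{\sigma,d,n}:S_n\to\mathbb{Q}$ is $$M_{\sigma,d,n}(\pi)=\frac{1}{|C_\pi|}\sum_{\pi'\in C_\pi}N_\sigma(\pi')^d,$$ where $C_\pi$ is the conjugacy class of $\pi$ in $S_n$. $M_{\sigma,d}$ is the function on $\coprod_{n\ge1}S_n$ whose restriction to $S_n$ is $M_{\sigma,d,n}$. For $i\ge 1$, $m_i(\pi)$ is the number of $i$-cycles in the cycle decomposition of $\pi$ (so $m_1$ counts fixed points); $n$ is regarded as the function with value $n$ on $S_n$. For a partition $\mu$ of $n$, $\chi^\mu$ is the irreducible complex character of $S_n$ indexed by $\mu$ in the standard way (so $\chi^{(n)}$ is the trivial character). For a partition $\lambda=(\lambda_1\ge\cdots\ge\lambda_\ell)$ write $|\lambda|=\sum_i\lambda_i$, and whenever $n-|\lambda|\ge\lambda_1$ let $\lambda[n]=(n-|\lambda|,\lambda_1,\ldots,\lambda_\ell)$, a partition of $n$; for the empty partition, $\varnothing[n]=(n)$. *)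

(* Defs.v *)
From mathcomp Require Import all_boot all_order all_algebra all_fingroup.
From mathcomp Require Import all_solvable all_field all_character.
From mathcomp Require Export mpoly.
Set Implicit Arguments.
Unset Strict Implicit.
Unset Printing Implicit Defensive.
Import GroupScope GRing.Theory.
Local Open Scope ring_scope.

Definition is_occurrence (k n : nat) (sigma : 'S_k) (pi : 'S_n)
    (i : {ffun 'I_k -> 'I_n}) : bool :=
  [forall a : 'I_k, forall b : 'I_k, (a < b)%N ==> (i a < i b)%N] &&
  [forall a : 'I_k, forall b : 'I_k,
     (pi (i a) < pi (i b))%N == (sigma a < sigma b)%N].

Definition pattern_count (k n : nat) (sigma : 'S_k) (pi : 'S_n) : nat :=
  #|[set i : {ffun 'I_k -> 'I_n} | is_occurrence sigma pi i]|.

Definition pattern_moment (k : nat) (sigma : 'S_k) (d n : nat) (pi : 'S_n)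
    : rat :=
  (#|pi ^: [set: 'S_n]|%:R)^-1 *
    \sum_(pi' in pi ^: [set: 'S_n]) (pattern_count sigma pi' ^ d)%N%:R.

Definition cycle_count (n i : nat) (pi : 'S_n) : nat :=
  #|[set c in porbits pi | #|c| == i]|.

(* In Q[y, x_1, ..., x_N], encoded as {mpoly rat[N.+1]}, the variable of index
   0 is y and the variable of index i > 0 is x_i. *)
Definition var_degree (i : nat) : nat := if i is 0 then 1 else i.

Definition weighted_degree_le (N : nat) (f : {mpoly rat[N.+1]}) (D : nat)
    : Prop :=
  forall m : 'X_{1..N.+1}, m \in msupp f ->
    (\sum_(i < N.+1) m i * var_degree i <= D)%N.

Definition cycle_point (N n : nat) (pi : 'S_n) (i : 'I_N.+1) : rat :=
  if i == 0%N :> nat then n%:R else (cycle_count i pi)%:R.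

(* Integer partitions are nonincreasing sequences of positive integers. *)
Definition is_partition (la : seq nat) : bool :=
  sorted geq la && (0%N \notin la).

(* A partition of size at most N has at most N parts, each at most N. *)
Definition partitions_upto (N : nat) : seq (seq nat) :=
  [seq la <- [seq map val (s : seq 'I_N.+1) | s : N.-bseq 'I_N.+1]
     | is_partition la && (sumn la <= N)%N].

Lemma uniq_partitions_upto (N : nat) : uniq (partitions_upto N).
Proof.
apply/filter_uniq; rewrite map_inj_uniq ?enum_uniq // => s t.
by move/(inj_map val_inj)/val_inj.
Qed.

Lemma mem_partitions_upto (N : nat) (la : seq nat) :
  (la \in partitions_upto N) = is_partition la && (sumn la <= N)%N.
Proof.
rewrite mem_filter andb_idr // => /andP[/andP[_ la_pos] la_le].
have size_le : (size la <= N)%N.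
  apply: leq_trans la_le; elim: la la_pos => //= x la IH.
  by rewrite inE negb_or eq_sym -lt0n => /andP[x0 /IH]; apply: leq_add x0.
have part_le x : x \in la -> (x <= N)%N.
  move=> x_la; apply: leq_trans la_le.
  by rewrite (perm_sumn (perm_to_rem x_la)) leq_addr.
have sizeP : (size [seq inord x : 'I_N.+1 | x <- la] <= N)%N by rewrite size_map.
apply/imageP; exists (Bseq sizeP) => //=.
rewrite -map_comp -[LHS]map_id; apply/eq_in_map => x /part_le x_le /=.
by rewrite inordK.
Qed.

(* la[n] *)
Definition pad_partition (n : nat) (la : seq nat) : seq nat :=
  (n - sumn la)%N :: la.

(* The standard tableau of shape mu, filled row by row from 0, has the entry x
   in row [reshape_index mu x] and column [reshape_offset mu x]. *)
Definition row_stab (n : nat) (mu : seq nat) : {set 'S_n} :=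
  [set s : 'S_n |
     [forall x : 'I_n, reshape_index mu (s x) == reshape_index mu x]].

Definition col_stab (n : nat) (mu : seq nat) : {set 'S_n} :=
  [set s : 'S_n |
     [forall x : 'I_n, reshape_offset mu (s x) == reshape_offset mu x]].

(* An element of the group algebra C[S_n] is a row vector of coordinates in the
   basis of group elements, on which S_n acts by right multiplication through
   [regular_repr]. *)
Definition young_symmetrizer (n : nat) (mu : seq nat)
    : 'rV[algC]_#|[set: 'S_n]| :=
  \sum_(p in row_stab n mu) \sum_(q in col_stab n mu)
    (-1) ^+ q *: delta_mx 0 (gring_index [set: 'S_n] (p * q)%g).

(* For a partition mu of n, the irreducible character indexed by mu is the one
   afforded by the Specht module of mu, realised as the right ideal of C[S_n]
   generated by the Young symmetrizer. *)
Definition specht_repr (n : nat) (mu : seq nat) :=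
  submod_repr (cyclic_mx_module (regular_repr algC [set: 'S_n]%G)
                                (young_symmetrizer n mu)).

Definition specht_char (n : nat) (mu : seq nat) : 'CF([set: 'S_n]) :=
  cfRepr (specht_repr n mu).

(* Main.v *)
Require Import Defs.
From mathcomp Require Import all_boot all_order all_algebra all_fingroup.
From mathcomp Require Import all_solvable all_field all_character.
From mathcomp Require Import mpoly.
From mathcomp Require Import zify ring.

Set Implicit Arguments.
Unset Strict Implicit.
Unset Printing Implicit Defensive.
Import GroupScope GRing.Theory Num.Theory.
Local Open Scope ring_scope.

(** Everything rests on the embedding counts [emb w pi]: for [w] in S_m, the
    number of injections phi of m points into n points with pi phi = phi w,
    that is, of copies of [w] inside [pi].

    The d-th power of a pattern count enumerates the maps h from d x k indices
    to positions for which the positions h and the values pi h are in a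
    prescribed relative order. Averaging over the conjugates of [pi] amounts to
    relabelling the n points at random, and the probability that positions and
    values then fall in the right order depends only on which of them coincide
    ([order_prob_kernel]), not on n. So the moment is a sum over h of a weight
    that sees only the coincidences among the h t and the arrows of [pi] between
    them. Sorting the h by kernel and by set of arrows leaves the injections of
    at most d k vertices that carry a given set of arrows to arrows of [pi].
    A vertex without outgoing arrow can be removed from such a problem
    ([span_graph_emb]), at the price of a factor of degree one in n, until a
    permutation of the vertices is left. Hence the moment is a combination of
    counts [emb w], for [w] in S_m with m <= d k, with coefficients polynomial
    in n of degree at most d k - m ([span_pattern_moment]); this is recorded by
    the inductive predicate [emb_span].

    For the first part, the maps phi with pi phi = phi w, injective or not, are
    counted by a product of fixed-point counts of powers of [pi]
    ([hom_perm]), and non-injective ones are embeddings of proper quotients of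
    [w]. By induction [emb w] is a polynomial of weighted degree m in the cycle
    counts ([cycle_poly_emb]).

    For the second part it suffices that, for n >= 2 d k and [w] in S_m, the
    class function [emb w] is a combination of the characters of the padded
    shapes la[n] = (n - |la|, la) with |la| <= m, with coefficients that do not
    depend on n. The classical argument with Young symmetrizers shows that the
    Specht characters are orthonormal ([specht_orth]). They are all the
    irreducible characters, because a class is determined by its cycle type: the polynomial [emb w]
    takes the same value at [pi] and at [w] when these have the same cycle
    counts, and an embedding between permutations of n points conjugates one to
    the other ([same_cycles_conjugate]). The coefficient of the character of
    la[n] in [emb w] vanishes for |la| > m because the columns are then too few
    to separate the n - m points outside the copy of [w] ([emb_specht0]). It is
    constant in n for two reasons. The inner product of two embedding counts is
    a number of ways to overlap two permutations ([cfdot_emb_emb]). And the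
    permutation character of the row stabilizer of la[n], which is a
    combination of embedding counts with constant coefficients, is the
    character of la[n] plus characters of strictly more dominant shapes, so
    that induction along dominance ([emb_specht_stable]) reduces every
    coefficient to such inner products. *)

(** * Kernels of maps between finite sets *)

Section KernelCanon.
Variable T : finType.

(** A map is recorded up to relabelling of its values by sending each point to
    a chosen point with the same value. The choice depends on the fibre alone,
    so that maps with the same kernel have equal [canon] and kernels can be
    compared and summed over as functions. *)
Definition canon (R : eqType) (f : T -> R) : {ffun T -> T} :=
  [ffun t => odflt t [pick u | f u == f t]].

Lemma canonK (R : eqType) (f : T -> R) t : f (canon f t) = f t.
Proof. by rewrite ffunE; case: pickP => [u /eqP|]. Qed.

Lemma canon_eq (R : eqType) (f : T -> R) t u :
  (canon f t == canon f u) = (f t == f u).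
Proof.
apply/eqP/eqP => [e|e]; first by rewrite -(canonK f t) e canonK.
rewrite !ffunE e; case: pickP => // /(_ u).
by rewrite eqxx.
Qed.

Lemma eq_canon (R R' : eqType) (f : T -> R) (g : T -> R') :
  (forall t u, (f t == f u) = (g t == g u)) -> canon f = canon g.
Proof.
move=> e; apply/ffunP => t; rewrite !ffunE.
by under eq_pick do rewrite e.
Qed.

Lemma canon_canon (R : eqType) (f : T -> R) : canon (canon f) = canon f.
Proof. by apply: eq_canon => t u; rewrite canon_eq. Qed.

(** The quotient of [T] by the kernel of [c], as the set of chosen points. *)
Definition classes_of (c : {ffun T -> T}) := {x : T | c x == x}.

Lemma canon_idem (c : {ffun T -> T}) t : canon c = c -> c (c t) = c t.
Proof. by move=> e; rewrite -{2}e canonK. Qed.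

Definition class_proj (c : {ffun T -> T}) (e : canon c = c) (t : T) :
  classes_of c := exist (fun x => c x == x) (c t) (introT eqP (canon_idem t e)).

Lemma class_projK (c : {ffun T -> T}) (e : canon c = c) (v : classes_of c) :
  class_proj e (val v) = v.
Proof. by apply: val_inj => /=; apply/eqP/(valP v). Qed.

Lemma class_proj_eq (c : {ffun T -> T}) (e : canon c = c) t u :
  (class_proj e t == class_proj e u) = (c t == c u).
Proof. by rewrite -val_eqE. Qed.

Lemma card_classes_of (c : {ffun T -> T}) : (#|{: classes_of c}| <= #|T|)%N.
Proof. by rewrite card_sig max_card. Qed.

End KernelCanon.

(** A map factors through the classes of its kernel, by an injection. *)
Lemma sum_over_kernels (T : finType) (R : finType) (c : {ffun T -> T})
    (e : canon c = c) (V : nmodType) (G : {ffun T -> R} -> V) :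
  \sum_(h : {ffun T -> R} | canon h == c) G h =
  \sum_(phi : {ffun classes_of c -> R} | injectiveb phi)
     G [ffun t => phi (class_proj e t)].
Proof.
rewrite (reindex_onto (fun phi : {ffun classes_of c -> R} =>
            [ffun t => phi (class_proj e t)])
          (fun h => [ffun v => h (val v)])) /=; last first.
  move=> h /eqP hc; apply/ffunP => t; rewrite !ffunE /=.
  by rewrite -{1}hc canonK.
apply: eq_bigl => phi; apply/andP/injectiveP.
  move=> [/eqP k _] v v' ev; rewrite -(class_projK e v) -(class_projK e v').
  apply/eqP; rewrite class_proj_eq.
  have := canon_eq [ffun t => phi (class_proj e t)] (val v) (val v').
  by rewrite k !ffunE !class_projK ev eqxx.
move=> inj; split; last by apply/eqP/ffunP => v; rewrite !ffunE class_projK.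
apply/eqP; rewrite -[RHS]e; apply/eq_canon => t u; rewrite !ffunE (inj_eq inj).
exact: class_proj_eq.
Qed.

(** Each map gives the list of its distinct values, one for each fibre.
    Completing both lists by the missing points of [R] gives two enumerations
    of [R], and the permutation matches them position by position. *)
Lemma perm_ext (T R : finType) (f g : T -> R) :
  (forall t u, (f t == f u) = (g t == g u)) ->
  exists a : {perm R}, forall t, a (f t) = g t.
Proof.
move=> e.
pose c := canon f; pose s := undup [seq c t | t <- enum T].
have uf : uniq (map f s).
  rewrite map_inj_in_uniq ?undup_uniq // => t u.
  rewrite !mem_undup => /mapP[t' _ ->] /mapP[u' _ ->].
  by rewrite !canonK => /eqP ff; apply/eqP; rewrite canon_eq.
have ug : uniq (map g s).
  rewrite map_inj_in_uniq ?undup_uniq // => t u.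
  rewrite !mem_undup => /mapP[t' _ ->] /mapP[u' _ ->].
  by rewrite /c (eq_canon e) !canonK => /eqP ff; apply/eqP; rewrite canon_eq.
(* The points that the list misses, in a fixed order. *)
pose compl (l : seq R) := [seq x <- enum R | x \notin l].
have perm_compl l : uniq l -> perm_eq (l ++ compl l) (enum R).
  move=> ul; apply: uniq_perm; rewrite ?enum_uniq //.
    rewrite cat_uniq ul filter_uniq ?enum_uniq // andbT.
    by apply/hasPn => x; rewrite mem_filter => /andP[].
  by move=> x; rewrite mem_cat mem_filter mem_enum andbT orbN.
pose lf := map f s ++ compl (map f s); pose lg := map g s ++ compl (map g s).
have pf : perm_eq lf (enum R) by apply: perm_compl.
have pg : perm_eq lg (enum R) by apply: perm_compl.
have memf x : x \in lf by rewrite (perm_mem pf) mem_enum.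
have sz : size lf = size lg by rewrite (perm_size pf) (perm_size pg).
have ulf : uniq lf by rewrite (perm_uniq pf) enum_uniq.
have ulg : uniq lg by rewrite (perm_uniq pg) enum_uniq.
have inj : injective (fun x => nth x lg (index x lf)).
  move=> x y; rewrite (set_nth_default y) -?sz ?index_mem // => /eqP.
  rewrite nth_uniq -?sz ?index_mem // => /eqP ei.
  by rewrite -(nth_index x (memf x)) ei nth_index.
exists (perm inj) => t; rewrite permE.
have cs : c t \in s by rewrite mem_undup map_f ?mem_enum.
have i_lt : (index (c t) s < size s)%N by rewrite index_mem.
rewrite -(canonK f t) -/c.
have -> : index (f (c t)) lf = index (c t) s.
  rewrite /lf index_cat map_f // -{1}(nth_index t cs).
  rewrite -(nth_map t (f t)) // index_uniq ?size_map //.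
rewrite /lg nth_cat size_map i_lt (nth_map t) // nth_index //.
by apply/eqP; rewrite -e canonK.
Qed.

(** * Embedding counts *)

Section Emb.
Variables (V : finType) (n : nat).

Definition embeddings (f : V -> V) (pi : 'S_n) : {set {ffun V -> 'I_n}} :=
  [set phi : {ffun V -> 'I_n} |
     injectiveb phi & [forall v, pi (phi v) == phi (f v)]].

Definition emb (f : V -> V) (pi : 'S_n) : nat := #|embeddings f pi|.

(** Here only the arrows in [E] are prescribed: a vertex may have no outgoing
    arrow, and then [pi] is free on its image. *)
Definition graph_emb (E : {set V * V}) (pi : 'S_n) : nat :=
  #|[set phi : {ffun V -> 'I_n} |
     injectiveb phi & [forall e in E, pi (phi e.1) == phi e.2]]|.

End Emb.

Lemma sum_embeddings (V : finType) n (f : V -> V) (pi : 'S_n) (R : pzSemiRingType) :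
  (emb f pi)%:R = \sum_(phi : {ffun V -> 'I_n} | injectiveb phi)
     ([forall v, pi (phi v) == phi (f v)] : nat)%:R :> R.
Proof.
rewrite -natr_sum; congr (_%:R); rewrite /emb -sum1_card.
rewrite [LHS]big_mkcond [RHS]big_mkcond /=.
by apply: eq_bigr => phi _; rewrite inE; case: (injectiveb phi); case: [forall v, _].
Qed.

(** * Combinations of embedding counts *)

(** Functions of a permutation of any size that are combinations of counts
    [emb w], with [w] in S_m, whose coefficients are polynomials in the size n;
    the index bounds the sum of m and of the degree of the coefficient. The
    inductive form lets each property of such combinations be checked on the
    generators. *)
Inductive emb_span : nat -> (forall n, 'S_n -> rat) -> Prop :=
| span_emb m (w : 'S_m) : emb_span m (fun n pi => (emb w pi)%:R)
| span_add D F1 F2 : emb_span D F1 -> emb_span D F2 ->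
    emb_span D (fun n pi => F1 n pi + F2 n pi)
| span_scale D (a : rat) F : emb_span D F -> emb_span D (fun n pi => a * F n pi)
| span_size D F : emb_span D F -> emb_span D.+1 (fun n pi => n%:R * F n pi)
| span_le D D' F : (D <= D')%N -> emb_span D F -> emb_span D' F
| span_ext D F F' : (forall n pi, F n pi = F' n pi) -> emb_span D F ->
    emb_span D F'.

Lemma span0 D : emb_span D (fun n pi => 0).
Proof.
apply: (span_le (leq0n D)).
apply: (span_ext _ (span_scale 0 (span_emb (1 : 'S_0)%g))) => n pi.
by rewrite mul0r.
Qed.

Lemma span_sum D (I : Type) (r : seq I) (P : pred I) F :
  (forall i, P i -> emb_span D (F i)) ->
  emb_span D (fun n pi => \sum_(i <- r | P i) F i n pi).
Proof.
move=> sF; elim: r => [|i r IHr].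
  by apply: span_ext (span0 D) => n pi; rewrite big_nil.
case Pi: (P i); last by apply: span_ext IHr => n pi; rewrite big_cons Pi.
apply: (span_ext _ (span_add (sF i Pi) IHr)) => n pi.
by rewrite big_cons Pi.
Qed.

Lemma span_sub D F1 F2 : emb_span D F1 -> emb_span D F2 ->
  emb_span D (fun n pi => F1 n pi - F2 n pi).
Proof.
move=> s1 s2; apply: (span_ext _ (span_add s1 (span_scale (-1) s2))) => n pi.
by rewrite mulN1r.
Qed.

Lemma emb_transport (V W : finType) (g : V -> W) (f : V -> V) (f' : W -> W)
    n (pi : 'S_n) :
  bijective g -> (forall v, f' (g v) = g (f v)) -> emb f pi = emb f' pi.
Proof.
move=> [g' gK g'K] fg.
pose pull (psi : {ffun W -> 'I_n}) : {ffun V -> 'I_n} := [ffun v => psi (g v)].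
have pull_inj : injective pull.
  move=> p q /ffunP e; apply/ffunP => x.
  by have := e (g' x); rewrite !ffunE g'K.
rewrite /emb -(card_imset _ pull_inj); congr #|pred_of_set _|.
apply/setP => phi; apply/idP/imsetP; last first.
  move=> [psi]; rewrite inE => /andP[/injectiveP ip /forallP eqv] ->.
  rewrite inE; apply/andP; split.
    apply/injectiveP => x y; rewrite !ffunE => /ip.
    exact: (can_inj gK).
  by apply/forallP => v; rewrite !ffunE -fg.
rewrite inE => /andP[/injectiveP ip /forallP eqv].
exists [ffun x => phi (g' x)]; last by apply/ffunP => v; rewrite !ffunE gK.
rewrite inE; apply/andP; split.
  apply/injectiveP => x y; rewrite !ffunE => /ip.
  exact: (can_inj g'K).
apply/forallP => x; rewrite !ffunE -{2}(g'K x) fg gK.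
exact: eqv.
Qed.

Lemma emb_noninj (V : finType) (f : V -> V) n (pi : 'S_n) :
  ~~ injectiveb f -> emb f pi = 0%N.
Proof.
move=> nf; apply/eqP; rewrite cards_eq0; apply/eqP/setP => phi.
rewrite !inE; apply/negP => /andP[/injectiveP ip /forallP eqv].
case/negP: nf; apply/injectiveP => u v e.
by apply/ip/(@perm_inj _ pi); rewrite (eqP (eqv u)) (eqP (eqv v)) e.
Qed.

Lemma span_emb_fun (V : finType) (f : V -> V) :
  emb_span #|V| (fun n pi => (emb f pi)%:R).
Proof.
have [fi|nf] := boolP (injectiveb f); last first.
  by apply: span_ext (span0 _) => n pi; rewrite emb_noninj.
have inj : injective (fun i : 'I_#|V| => enum_rank (f (enum_val i))).
  by move=> i j /enum_rank_inj/(injectiveP _ fi)/enum_val_inj.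
apply: (span_ext _ (span_emb (perm inj))) => n pi; congr (_%:R).
apply/esym/(emb_transport pi (enum_rank_bij V)) => v.
by rewrite permE enum_rankK.
Qed.

Section RemoveVertex.
Variables (V : finType) (v : V) (n : nat).
Let V' := {x : V | x != v}.

Definition extend_at (p : {ffun V' -> 'I_n} * 'I_n) : {ffun V -> 'I_n} :=
  [ffun x => if insub x is Some x' then p.1 x' else p.2].

Lemma extend_at_val p (x : V') : extend_at p (val x) = p.1 x.
Proof. by rewrite ffunE valK. Qed.

Lemma extend_at_new p : extend_at p v = p.2.
Proof. by rewrite ffunE insubF // eqxx. Qed.

Lemma vertexP (x : V) : x = v \/ exists x' : V', x = val x'.
Proof.
by have [->|nx] := eqVneq x v; [left | right; exists (Sub x nx)].
Qed.

Lemma sum_extend_at (P : pred {ffun V -> 'I_n}) :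
  #|[set phi | P phi]| =
  (\sum_(phi : {ffun V' -> 'I_n}) #|[set y | P (extend_at (phi, y))]|)%N.
Proof.
rewrite -sum1_card; under eq_bigl do rewrite inE.
rewrite (reindex extend_at) /=; last first.
  exists (fun phi => ([ffun x : V' => phi (val x)], phi v)) => [[p y] _|phi _].
    congr (_, _); last exact: extend_at_new.
    by apply/ffunP => x; rewrite !ffunE valK.
  apply/ffunP => x; have [->|[x' ->]] := vertexP x; first exact: extend_at_new.
  by rewrite extend_at_val ffunE.
under [RHS]eq_bigr do rewrite -sum1_card.
rewrite pair_big_dep /=.
by apply: eq_bigl => -[p y]; rewrite !inE.
Qed.

Lemma injective_extend_at p :
  injectiveb (extend_at p) = injectiveb p.1 && (p.2 \notin codom p.1).
Proof.
apply/injectiveP/andP => [inj|[/injectiveP inj nc]].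
  split; first by apply/injectiveP => x y e; apply/val_inj/inj; rewrite !extend_at_val.
  apply/negP => /codomP[x e].
  have : extend_at p v = extend_at p (val x) by rewrite extend_at_new extend_at_val.
  by move/inj => ev; have := valP x; rewrite -ev eqxx.
have nv (x : V') : p.2 <> p.1 x by move=> e; case/negP: nc; rewrite e codom_f.
move=> x y; have [->|[x' ->]] := vertexP x; have [->|[y' ->]] := vertexP y => //;
  rewrite ?extend_at_new ?extend_at_val.
- by move/nv.
- by move/esym/nv.
- by move/inj ->.
Qed.

End RemoveVertex.

Section GraphEmb.
Variables (V : finType) (E : {set V * V}) (v : V).
Hypothesis no_out : forall x, (v, x) \notin E.
Let V' := {x : V | x != v}.

Definition remove_vertex : {set V' * V'} :=
  [set e : V' * V' | (val e.1, val e.2) \in E].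

Lemma graph_emb_remove n (pi : 'S_n) :
  graph_emb E pi =
  (\sum_(phi : {ffun V' -> 'I_n} |
        injectiveb phi && [forall e in remove_vertex, pi (phi e.1) == phi e.2])
     #|[set y | (y \notin codom phi) &&
         [forall u : V', ((val u, v) \in E) ==> (pi (phi u) == y)]]|)%N.
Proof.
rewrite /graph_emb (sum_extend_at v) [RHS]big_mkcond /=.
apply: eq_bigr => phi _.
set Q := [forall e in remove_vertex, _].
have eQ y : [forall e in E, pi (extend_at (phi, y) e.1) == extend_at (phi, y) e.2]
   = Q && [forall u : V', ((val u, v) \in E) ==> (pi (phi u) == y)].
  apply/forall_inP/andP => [h|[/forall_inP hQ /forallP hu] [a b] /=].
    split.
      apply/forall_inP => -[a b]; rewrite inE /= => /h /=.
      by rewrite !extend_at_val.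
    apply/forallP => u; apply/implyP => /h /=.
    by rewrite extend_at_val extend_at_new.
  have [->|[a' ->]] := vertexP v a; first by rewrite (negPf (no_out _)).
  have [->|[b' ->]] := vertexP v b => ein.
    by rewrite extend_at_val extend_at_new; apply: (implyP (hu a')).
  by rewrite !extend_at_val; apply: (hQ (a', b')); rewrite inE.
under eq_finset do rewrite injective_extend_at eQ /=.
case: (injectiveb phi) => /=; last by rewrite -(cards0 'I_n); apply: eq_card => y; rewrite !inE.
move: eQ => _; case: Q => /=; first by [].
by rewrite -(cards0 'I_n); apply: eq_card => y; rewrite !inE andbF.
Qed.

End GraphEmb.

Lemma graph_embE (V : finType) (E : {set V * V}) n (pi : 'S_n) :
  graph_emb E pi = (\sum_(phi : {ffun V -> 'I_n} |
     injectiveb phi && [forall e in E, pi (phi e.1) == phi e.2]) 1)%N.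
Proof. by rewrite /graph_emb -sum1_card; apply: eq_bigl => phi; rewrite inE. Qed.

(** By induction on the number of vertices. If every vertex has an outgoing
    arrow, [E] is the graph of a self-map of [V], or no embedding exists.
    Otherwise let [v] be a vertex without outgoing arrow. If no arrow ends at
    [v], its image is any of the n - (|V| - 1) points not yet used. If u -> v
    is the only arrow that ends at [v], the image of [v] is forced to be the
    successor of the image of [u], and the embeddings without [v] for which
    this works are all of them, minus those for which the successor is already
    the image of some vertex x, which are the embeddings with the additional
    arrow u -> x. *)
Lemma span_graph_emb (V : finType) (E : {set V * V}) :
  emb_span #|V| (fun n pi => (graph_emb E pi)%:R).
Proof.
have [s le_s] := ubnP #|V|; elim: s => // s IHs in V E le_s *.
have [/forallP all_out|/forallPn[v /existsPn no_out]] :=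
    boolP [forall u, exists x, (u, x) \in E].
  pose f u := odflt u [pick x | (u, x) \in E].
  have fE u : (u, f u) \in E.
    rewrite /f; case: pickP => [//|none].
    by case/existsP: (all_out u) => x; rewrite none.
  have [/forall_inP fun_E|/forall_inPn[[a b] abE /= nab]] :=
      boolP [forall e in E, f e.1 == e.2].
    apply: (span_ext _ (span_emb_fun f)) => n pi; congr (_%:R).
    apply: eq_card => phi; rewrite !inE; congr (_ && _).
    apply/forallP/forall_inP => [h e eE|h u].
      by rewrite (eqP (h e.1)) (eqP (fun_E e eE)).
    exact: (h (u, f u)).
  (* Two arrows leave [a]. *)
  apply: (span_ext _ (span0 _)) => n pi; apply/esym/eqP.
  rewrite pnatr_eq0 cards_eq0; apply/eqP/setP => phi; rewrite !inE.
  apply/negP => /andP[/injectiveP inj /forall_inP h].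
  case/eqP: nab; apply: inj.
  by rewrite -(eqP (h _ (fE a))) (eqP (h _ abE)).
pose V' : finType := {x : V | x != v}.
have cV' : #|V| = #|V'|.+1.
  by rewrite card_sig (cardC1 v) prednK //; apply/card_gt0P; exists v.
have lt_s : (#|V'| < s)%N by rewrite -ltnS -cV'.
pose E' := remove_vertex E v.
have [no_in|/forallPn[u /negPn uE]] := boolP [forall u : V', (val u, v) \notin E].
  have sE' := IHs V' E' lt_s.
  rewrite cV'; apply: (span_ext _ (span_sub (span_size sE')
      (span_le (leqnSn _) (span_scale #|V'|%:R sE')))) => n pi.
  rewrite -mulrBl (graph_emb_remove no_out) graph_embE !natr_sum mulr_sumr.
  apply: eq_bigr => phi /andP[/injectiveP inj _]; rewrite mulr1.
  have -> : [set y | (y \notin codom phi) &&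
      [forall u : V', ((val u, v) \in E) ==> (pi (phi u) == y)]] =
      ~: [set y in codom phi].
    apply/setP => y; rewrite !inE; case: (_ \in _) => //=.
    by apply/forallP => u; rewrite (negPf (forallP no_in u)).
  have cc : #|[set y in codom phi]| = #|V'| by rewrite cardsE card_codom.
  have le : (#|V'| <= n)%N by rewrite -{1}(card_ord n) -cc max_card.
  by rewrite cardsCs setCK card_ord cc natrB.
have [u_unique|] := boolP [forall u' : V', ((val u', v) \in E) ==> (u' == u)]; last first.
  case/forallPn => u'; rewrite negb_imply => /andP[u'E nu].
  (* Two arrows end at [v], which no injective [pi] allows. *)
  apply: (span_ext _ (span0 _)) => n pi; apply/esym/eqP.
  rewrite pnatr_eq0 cards_eq0; apply/eqP/setP => phi; rewrite !inE.
  apply/negP => /andP[/injectiveP inj /forall_inP h].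
  case/eqP: nu; apply/val_inj/inj/(@perm_inj _ pi).
  by rewrite (eqP (h _ uE)) (eqP (h _ u'E)).
apply: (span_le (D := #|V'|)); first by rewrite cV'.
apply: (span_ext _ (span_sub (IHs V' E' lt_s)
  (span_sum (index_enum V') (P := predT) (fun x _ => IHs V' ((u, x) |: E') lt_s)))) => n pi.
rewrite (graph_emb_remove no_out) !graph_embE !natr_sum /=.
under [X in _ - X = _]eq_bigr do rewrite graph_embE natr_sum big_mkcond /=.
rewrite exchange_big /= big_mkcond [RHS]big_mkcond -sumrB.
apply: eq_bigr => phi _.
have eE x : [forall e in (u, x) |: E', pi (phi e.1) == phi e.2] =
    (pi (phi u) == phi x) && [forall e in E', pi (phi e.1) == phi e.2].
  apply/forall_inP/andP => [h|[hx /forall_inP h] e].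
    split; first by apply: (h (u, x)); rewrite !inE eqxx.
    by apply/forall_inP => e ein; apply: h; rewrite in_setU ein orbT.
  by rewrite 2!inE => /orP[/eqP -> //|/h].
under eq_bigr do rewrite eE.
have [inj|_] := boolP (injectiveb phi); last by rewrite big1 ?subr0.
have [_|_] := boolP [forall e in E', pi (phi e.1) == phi e.2]; last first.
  by rewrite big1 ?subr0 // => x _; rewrite andbF.
have one_in y : [forall u' : V', ((val u', v) \in E) ==> (pi (phi u') == y)]
    = (pi (phi u) == y).
  apply/forallP/eqP => [/(_ u)|<- u'].
    by rewrite uE => /eqP.
  by apply/implyP => /(implyP (forallP u_unique u'))/eqP ->.
under eq_finset do rewrite one_in.
rewrite -big_mkcond /=; under eq_bigl do rewrite andbT.
have [/codomP[x0 ex0]|nc] := boolP (pi (phi u) \in codom phi).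
  rewrite (eq_bigl (pred1 x0)) => [|x]; last first.
    by rewrite ex0 (inj_eq (injectiveP _ inj)) eq_sym.
  rewrite big_pred1_eq subrr; apply/esym/eqP; rewrite pnatr_eq0.
  rewrite cards_eq0; apply/eqP/setP => y; rewrite !inE andbC.
  by case: eqP => // <-; rewrite ex0 codom_f.
rewrite big_pred0 ?subr0 => [|x]; last first.
  by apply/eqP => e; rewrite e codom_f in nc.
congr (_%:R); rewrite -(cards1 (pi (phi u))); apply: eq_card => y.
by rewrite !inE andbC [_ == y]eq_sym; case: eqP => //= ->; rewrite nc.
Qed.

Definition arrows (T : finType) n (pi : 'S_n) (h : T -> 'I_n) : {set T * T} :=
  [set e | pi (h e.1) == h e.2].

(** Inclusion-exclusion: an embedding that respects [E] has as its set of arrows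
    [E] or a larger set, and the larger sets are known by induction. *)
Lemma span_exact_arrows (V : finType) (E : {set V * V}) :
  emb_span #|V| (fun n pi => (#|[set phi : {ffun V -> 'I_n} |
     injectiveb phi & arrows pi phi == E]|)%:R).
Proof.
have [s le_s] := ubnP #|~: E|; elim: s => // s IHs in E le_s *.
have sup_lt (E1 : {set V * V}) : E \proper E1 -> (#|~: E1| < s)%N.
  by rewrite -properC => /proper_card h; apply: leq_trans h _; rewrite -ltnS.
apply: (span_ext _ (span_sub (span_graph_emb E)
  (span_sum (index_enum {set V * V}) (P := fun E1 => E \proper E1)
     (fun E1 lE => IHs E1 (sup_lt E1 lE))))) => n pi /=.
apply/eqP; rewrite subr_eq; apply/eqP.
rewrite graph_embE natr_sum (partition_big (fun phi : {ffun V -> 'I_n} => arrows pi phi)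
  (fun E1 => E \subset E1)) /=; last first.
  move=> phi /andP[_ /forall_inP h]; apply/subsetP => e /h.
  by rewrite inE.
rewrite (bigD1 E) //=; congr (_ + _).
  rewrite -natr_sum; congr (_%:R); rewrite sum1_card; apply: eq_card => phi.
  rewrite !inE [LHS]/in_mem /=; case: injectiveb => //=.
  case: eqP; rewrite ?andbF // => eE; rewrite andbT.
  by apply/forall_inP => e; rewrite -eE inE.
apply: eq_big => [E1|E1 /andP[lE _]]; first by rewrite properEneq andbC eq_sym.
rewrite -natr_sum; congr (_%:R); rewrite sum1_card; apply: eq_card => phi.
rewrite !inE [LHS]/in_mem /=; case: injectiveb => //=.
case: eqP; rewrite ?andbF // => eE; rewrite andbT.
by apply/forall_inP => e /(subsetP lE); rewrite -eE inE.
Qed.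

Lemma span_arrows_inj (V : finType) (p : {set V * V} -> rat) :
  emb_span #|V| (fun n pi =>
    \sum_(phi : {ffun V -> 'I_n} | injectiveb phi) p (arrows pi phi)).
Proof.
apply: (span_ext _ (span_sum (index_enum {set V * V}) (P := predT)
   (fun E _ => span_scale (p E) (span_exact_arrows E)))) => n pi.
rewrite (partition_big (fun phi : {ffun V -> 'I_n} => arrows pi phi) predT) //=.
apply: eq_bigr => E _; rewrite (eq_bigr (fun _ => p E)); last first.
  by move=> phi /andP[_ /eqP ->].
rewrite big_const iter_addr_0 mulr_natr; congr (_ *+ _); apply: eq_card => phi.
by rewrite !inE.
Qed.

(** The form in which moments arise: the weight [p] sees which values of [h]
    coincide and which are successors of each other under [pi]. *)
Lemma span_kernel_arrows (T : finType)
    (p : {ffun T -> T} -> {set T * T} -> rat) :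
  emb_span #|T| (fun n pi =>
    \sum_(h : {ffun T -> 'I_n}) p (canon h) (arrows pi h)).
Proof.
pose F (c : {ffun T -> T}) n (pi : 'S_n) :=
  \sum_(h : {ffun T -> 'I_n} | canon h == c) p (canon h) (arrows pi h).
have sF c : emb_span #|T| (F c).
  have [e|/eqP ne] := eqVneq (canon c) c; last first.
    apply: (span_ext _ (span0 _)) => n pi; rewrite /F big_pred0 // => h.
    by apply/eqP => hc; apply: ne; rewrite -hc canon_canon.
  apply: (span_le (card_classes_of c)).
  pose q (E : {set classes_of c * classes_of c}) :=
    p c [set e' | (class_proj e e'.1, class_proj e e'.2) \in E].
  apply: (span_ext _ (span_arrows_inj q)) => n pi.
  rewrite /F (eq_bigr (fun h : {ffun T -> 'I_n} => p c (arrows pi h))); last first.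
    by move=> h /eqP ->.
  rewrite (sum_over_kernels e); apply: eq_bigr => phi _.
  by rewrite /q; congr (p c _); apply/setP => x; rewrite !inE !ffunE.
apply: (span_ext _ (span_sum (index_enum {ffun T -> T}) (P := predT)
   (fun c _ => sF c))) => n pi.
by rewrite (partition_big (fun h : {ffun T -> 'I_n} => canon h) predT).
Qed.

(** * Relative order under a random relabelling *)

Definition order_type (X : finType) n (H : X -> 'I_n) : {set X * X} :=
  [set e | (H e.1 < H e.2)%N].

Section RelativeOrder.
Variables (X : finType) (good : pred {set X * X}).

(** The probability that a uniformly random relabelling puts the values of [H]
    in a good relative order. *)
Definition order_prob n (H : X -> 'I_n) : rat :=
  #|[set tau : 'S_n | good (order_type (tau \o H))]|%:R / n`!%:R.

(** [beta] ranks the values of [phi]. *)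
Lemma standardize n N (phi : 'I_n -> 'I_N) : injective phi ->
  exists beta : 'S_n, forall i j, (beta i < beta j)%N = (phi i < phi j)%N.
Proof.
move=> inj.
pose r i := #|[set j : 'I_n | (phi j < phi i)%N]|.
have mono i j : (phi i < phi j)%N -> (r i < r j)%N.
  move=> lt; apply: proper_card; apply/properP; split.
    by apply/subsetP => x; rewrite !inE => /ltn_trans; apply.
  by exists i; rewrite !inE ?ltnn.
have r_lt i : (r i < n)%N.
  rewrite -[X in (_ < X)%N](card_ord n) -cardsT; apply: proper_card.
  by rewrite properT; apply/negP => /eqP/setP/(_ i); rewrite !inE ltnn.
have r_mono i j : (r i < r j)%N = (phi i < phi j)%N.
  apply/idP/idP; last exact: mono.
  case: (ltngtP (phi i) (phi j)) => // [/mono h1 h2|].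
    by have := ltn_trans h1 h2; rewrite ltnn.
  by move/val_inj/inj ->; rewrite ltnn.
have r_inj : injective (fun i => Ordinal (r_lt i)).
  move=> i j [e]; apply/inj/val_inj.
  by have := (r_mono i j); have := r_mono j i; rewrite e ltnn; case: ltngtP.
by exists (perm r_inj) => i j; rewrite !permE /= r_mono.
Qed.

Lemma perm_lt_inj n (b1 b2 : 'S_n) :
  (forall i j, (b1 i < b1 j)%N = (b2 i < b2 j)%N) -> b1 = b2.
Proof.
move=> e; apply/permP => i; apply: val_inj.
have rank (b : 'S_n) : val (b i) = #|[set j : 'I_n | (b j < b i)%N]|.
  have -> : [set j : 'I_n | (b j < b i)%N] = b @^-1: [set j : 'I_n | (j < b i)%N].
    by apply/setP => j; rewrite !inE.
  rewrite card_preimset; last exact: perm_inj.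
  rewrite -sum1_card; under eq_bigl do rewrite inE.
  by rewrite -(big_ord_widen n (fun=> 1%N)) ?sum1_card ?card_ord // ltnW.
by rewrite [LHS]rank [RHS]rank; congr #|pred_of_set _|; apply/setP => j; rewrite !inE e.
Qed.

(** The relative order of the values of tau phi is that of a permutation beta
    of n points, and all beta are equally likely: a permutation of the N points
    that extends [beta] along [phi] carries by translation the tau with
    standardization 1 to those with standardization [beta]. *)
Lemma order_prob_inj n N (phi : 'I_n -> 'I_N) (H : X -> 'I_n) :
  injective phi -> order_prob (phi \o H) = order_prob H.
Proof.
move=> inj.
have std_ex (tau : 'S_N) : {beta : 'S_n |
    [forall i, forall j, (beta i < beta j)%N == (tau (phi i) < tau (phi j))%N]}.
  apply/sigW; have [|beta hb] := @standardize _ _ (tau \o phi).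
    by move=> i j /perm_inj/inj.
  by exists beta; apply/'forall_'forall_eqP.
pose std tau := sval (std_ex tau).
have stdP tau i j : (std tau i < std tau j)%N = (tau (phi i) < tau (phi j))%N.
  by have /'forall_'forall_eqP := svalP (std_ex tau).
pose fib beta := #|[set tau | std tau == beta]|.
have fibE beta : fib beta = fib 1%g.
  have [|alpha ha] := @perm_ext _ _ phi (phi \o beta).
    by move=> t u; rewrite /= !(inj_eq inj) (inj_eq perm_inj).
  rewrite /fib -[RHS](card_imset _ (mulgI alpha)).
  apply: eq_card => tau; rewrite !inE; apply/eqP/imsetP => [e|[rho]].
    exists (alpha^-1 * tau)%g; last by rewrite mulKVg.
    rewrite inE; apply/eqP/perm_lt_inj => i j; rewrite stdP !permM.
    have inv k : (alpha^-1)%g (phi k) = phi ((beta^-1)%g k).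
      by apply: (@perm_inj _ alpha); rewrite permKV ha /= permKV.
    by rewrite !inv -stdP e !permKV perm1 perm1.
  rewrite inE => /eqP e ->; apply: perm_lt_inj => i j.
  by rewrite stdP !permM !ha /= -stdP e !perm1.
have count (S : {set 'S_n}) :
    #|[set tau | std tau \in S]| = (#|S| * fib 1%g)%N.
  rewrite -sum1_card (partition_big std (mem S)) => [|tau]; last by rewrite inE.
  rewrite -sum_nat_const; apply: eq_bigr => beta bS.
  rewrite -(fibE beta) sum1_card; apply: eq_card => tau.
  by rewrite !inE [LHS]/in_mem /= inE andbC; case: eqP => //= ->.
have total : N`! = (n`! * fib 1%g)%N.
  rewrite -(card_Sn n) -cardsT -count -(card_Sn N).
  by apply: eq_card => tau; rewrite !inE.
have fib_gt0 : (0 < fib 1%g)%N.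
  by have := fact_gt0 N; rewrite total muln_gt0 => /andP[].
rewrite /order_prob.
have -> : [set tau : 'S_N | good (order_type (tau \o (phi \o H)))] =
   [set tau | std tau \in [set beta : 'S_n | good (order_type (beta \o H))]].
  apply/setP => tau; rewrite !inE; congr good; apply/setP => e.
  by rewrite !inE /= stdP.
rewrite count total !natrM -mulf_div divff ?mulr1 //.
by rewrite pnatr_eq0 -lt0n.
Qed.

(** Inside the disjoint sum of their codomains, two maps with the same kernel
    differ by a permutation. *)
Lemma order_prob_kernel n n' (H : X -> 'I_n) (H' : X -> 'I_n') :
  (forall x y, (H x == H y) = (H' x == H' y)) -> order_prob H = order_prob H'.
Proof.
move=> e.
rewrite -(@order_prob_inj _ _ (@lshift n n') H) => [|i j]; last exact: lshift_inj.
rewrite -(@order_prob_inj _ _ (@rshift n n') H') => [|i j]; last exact: rshift_inj.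
have [|alpha ha] := @perm_ext _ _ (@lshift n n' \o H) (@rshift n n' \o H').
  by move=> x y /=; rewrite (inj_eq (@lshift_inj _ _)) (inj_eq (@rshift_inj _ _)).
rewrite /order_prob; congr (_%:R / _); rewrite -[RHS](card_imset _ (mulgI alpha)).
have eqt tau : order_type ((alpha * tau)%g \o (@lshift n n' \o H)) =
    order_type (tau \o (@rshift n n' \o H')).
  apply/setP => x; rewrite !inE /= !permM; congr (_ < _)%N;
  by congr (val (tau _)); exact: ha.
apply: eq_card => tau; rewrite inE; apply/idP/imsetP => [g|[rho]].
  by exists (alpha^-1 * tau)%g; rewrite ?inE ?mulKVg // -eqt mulKVg.
by rewrite inE -eqt => g ->.
Qed.
End RelativeOrder.

(** * Pattern moments *)

(** Each conjugate of [pi] is reached by as many tau as [pi] has centralizing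
    permutations. *)
Lemma class_average n (pi : 'S_n) (F : 'S_n -> rat) :
  (#|pi ^: [set: 'S_n]|%:R)^-1 * \sum_(pi' in pi ^: [set: 'S_n]) F pi' =
  (n`!%:R)^-1 * \sum_(tau : 'S_n) F (pi ^ tau)%g.
Proof.
pose C := 'C_[set: 'S_n][pi]%g.
have index : (#|C| * #|pi ^: [set: 'S_n]|)%N = n`!.
  by rewrite -index_cent1 Lagrange ?subsetIl // cardsT card_Sn.
rewrite [in RHS](partition_big (fun tau => pi ^ tau)%g (mem (pi ^: [set: 'S_n]))) /=; last first.
  by move=> tau _; rewrite memJ_class ?inE.
have fiber pi' : pi' \in pi ^: [set: 'S_n] ->
    \sum_(tau : 'S_n | (pi ^ tau)%g == pi') F (pi ^ tau)%g = #|C|%:R * F pi'.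
  case/imsetP => x _ ->; rewrite (eq_bigr (fun=> F (pi ^ x)%g)) => [|tau /eqP-> //].
  rewrite big_const iter_addr_0 mulr_natl; congr (_ *+ _).
  rewrite -(card_rcoset C x); apply: eq_card => tau; rewrite mem_rcoset /C in_setI in_setT cent1C.
  change ((pi ^ tau == pi ^ x)%g = (pi \in 'C[tau * x^-1]%g)).
  apply/eqP/cent1P => [e|].
    by apply/commgP/conjg_fixP; rewrite conjgM e conjgK.
  by move/commgP/conjg_fixP => e; rewrite -{2}e -conjgM mulgKV.
rewrite [in RHS](eq_bigr (fun pi' => #|C|%:R * F pi')); last first.
  by move=> pi' cl; exact: fiber.
rewrite -mulr_sumr mulrA; congr (_ * _).
have c0 : (#|C|%:R : rat) != 0 by rewrite pnatr_eq0 -lt0n cardG_gt0.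
by rewrite -index natrM invfM mulrC mulrA divff ?mul1r.
Qed.

Section Moment.
Variables (k d : nat) (sigma : 'S_k).
Local Notation T := ('I_d * 'I_k)%type.

(** The positions of [d] tuples of [k] indices, followed by the values of [pi]
    at these positions: being [d] occurrences of [sigma] is a condition on the
    relative order of this combined map. *)
Definition entries_and_values n (pi : 'S_n) (h : T -> 'I_n) (x : T + T) : 'I_n :=
  match x with inl t => h t | inr t => pi (h t) end.

Definition occurrences_order (O : {set (T + T) * (T + T)}) : bool :=
  [forall j : 'I_d,
     [forall a : 'I_k, forall b : 'I_k,
        (a < b)%N ==> ((inl (j, a), inl (j, b)) \in O)] &&
     [forall a : 'I_k, forall b : 'I_k,
        ((inr (j, a), inr (j, b)) \in O) == (sigma a < sigma b)%N]].

Lemma pattern_count_exp n (pi : 'S_n) :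
  (pattern_count sigma pi ^ d)%N = #|[set h : {ffun T -> 'I_n} |
     occurrences_order (order_type (entries_and_values pi h))]|.
Proof.
have /esym := @card_ffun_on 'I_d _ (mem [set i | is_occurrence sigma pi i]).
rewrite card_ord -/(pattern_count sigma pi) => ->.
pose uncurry (F : {ffun 'I_d -> {ffun 'I_k -> 'I_n}}) : {ffun T -> 'I_n} :=
  [ffun t => F t.1 t.2].
have inj : injective uncurry.
  move=> F F' /ffunP e; apply/ffunP => j; apply/ffunP => a.
  by have := e (j, a); rewrite !ffunE.
rewrite -(card_imset _ inj); apply: eq_card => h.
have occE (F : {ffun 'I_d -> {ffun 'I_k -> 'I_n}}) :
    occurrences_order (order_type (entries_and_values pi (uncurry F))) =
    [forall j, F j \in [set i | is_occurrence sigma pi i]].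
  apply: eq_forallb => j; rewrite inE /is_occurrence.
  congr (_ && _); apply: eq_forallb => a; apply: eq_forallb => b;
  by rewrite inE /= !ffunE.
rewrite inE; apply/imsetP/idP => [[F /ffun_onP on ->]|good_h].
  by rewrite occE; apply/forallP.
exists [ffun j => [ffun a => h (j, a)]]; last first.
  by apply/ffunP => -[j a]; rewrite !ffunE.
apply/ffun_onP => j; move: j; apply/forallP.
rewrite -occE; congr (is_true (occurrences_order _)): good_h.
by apply/setP => -[[t|t] [u|u]]; rewrite !inE /= !ffunE -!surjective_pairing.
Qed.

(** The kernel of the combined map of positions and values, in terms of the
    kernel [c] of the positions and of the arrows [E] between them. *)
Definition value_kernel (c : {ffun T -> T}) (E : {set T * T}) (x y : T + T) :=
  match x, y with
  | inl t, inl u => c t == c u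
  | inr t, inr u => c t == c u
  | inl t, inr u => (u, t) \in E
  | inr t, inl u => (t, u) \in E
  end.

(** Replacing [pi] by its conjugate under tau while moving the positions by tau
    applies tau to positions and values alike. The average over tau of the
    condition on their relative order is thus a probability that depends only
    on the kernel of the combined map. *)
Lemma span_pattern_moment :
  emb_span (d * k) (fun n pi => pattern_moment sigma d pi).
Proof.
(* A map into 'I_#|T + T| with the prescribed kernel serves for all sizes. *)
pose p (c : {ffun T -> T}) (E : {set T * T}) :=
  order_prob occurrences_order (fun x : T + T =>
    enum_rank (odflt x [pick u | value_kernel c E u x])).
have <- : #|{: T}| = (d * k)%N by rewrite card_prod !card_ord.
apply: (span_ext _ (span_kernel_arrows p)) => n pi; apply/esym.
rewrite /pattern_moment class_average.
have -> : \sum_(tau : 'S_n) (pattern_count sigma (pi ^ tau)%g ^ d)%N%:R =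
   \sum_(h : {ffun T -> 'I_n}) \sum_(tau : 'S_n)
     (occurrences_order (order_type (tau \o entries_and_values pi h)))%:R :> rat.
  rewrite exchange_big; apply: eq_bigr => tau _ /=.
  pose move_by (h : {ffun T -> 'I_n}) : {ffun T -> 'I_n} := [ffun t => tau (h t)].
  have inj : injective move_by.
    by move=> h h' /ffunP e; apply/ffunP => t; have := e t; rewrite !ffunE => /perm_inj.
  rewrite pattern_count_exp -sum1_card natr_sum big_mkcond (reindex_inj inj) /=.
  apply: eq_bigr => h _; rewrite inE.
  set O1 := order_type _; set O2 := order_type _.
  suff -> : O1 = O2 by case: occurrences_order.
  have eH x : entries_and_values (pi ^ tau)%g (move_by h) x =
      tau (entries_and_values pi h x).
    by case: x => t /=; rewrite ffunE // conjgE !permM permK.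
  by apply/setP => x; rewrite !inE !eH.
rewrite mulr_sumr; apply: eq_bigr => h _.
rewrite -natr_sum mulrC.
have -> : (\sum_(tau : 'S_n)
     occurrences_order (order_type (tau \o entries_and_values pi h)))%N =
   #|[set tau : 'S_n | occurrences_order (order_type (tau \o entries_and_values pi h))]|.
  rewrite -sum1_card [RHS]big_mkcond /=; apply: eq_bigr => tau _; rewrite inE.
  by case: occurrences_order.
rewrite -/(order_prob occurrences_order (entries_and_values pi h)).
apply: order_prob_kernel => x y; rewrite (inj_eq enum_rank_inj).
have kerE u w : value_kernel (canon h) (arrows pi h) u w =
    (entries_and_values pi h u == entries_and_values pi h w).
  case: u w => [t|t] [u|u] /=; rewrite ?canon_eq ?(inj_eq perm_inj) ?inE // eq_sym.
have pickE u : odflt u [pick w | value_kernel (canon h) (arrows pi h) w u] =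
    canon (entries_and_values pi h) u.
  by rewrite ffunE; under eq_pick do rewrite kerE.
by rewrite !pickE canon_eq.
Qed.

End Moment.

(** * Equivariant maps and their quotients *)

Definition equivariant (T : finType) (f : T -> T) n (pi : 'S_n) (h : T -> 'I_n) : bool :=
  [forall t, pi (h t) == h (f t)].

Definition quotient_map (T : finType) (c : {ffun T -> T}) (f : T -> T)
    (v : classes_of c) : classes_of c := insubd v (c (f (val v))).
Arguments quotient_map {T} c f v.

Definition respects (T : finType) (c : {ffun T -> T}) (f : T -> T) : bool :=
  [forall t, c (f (c t)) == c (f t)].

(** An equivariant map with kernel [c] forces [f] to descend to the quotient by
    [c], and is then an embedding of the quotient map. *)
Lemma sum_equivariant_kernel (T : finType) (c : {ffun T -> T}) (f : T -> T)
    n (pi : 'S_n) : canon c = c ->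
  (\sum_(h : {ffun T -> 'I_n} | canon h == c) equivariant f pi h =
   respects c f * emb (quotient_map c f) pi)%N.
Proof.
move=> e; rewrite (sum_over_kernels e).
have qE v : quotient_map c f v = class_proj e (f (val v)).
  by apply: val_inj; rewrite val_insubd (canon_idem _ e) eqxx.
rewrite /emb -sum1_card big_distrr /=.
rewrite [RHS]big_mkcond [LHS]big_mkcond; apply: eq_bigr => phi _.
rewrite inE; have [/injectiveP inj|//] := boolP (injectiveb phi).
rewrite muln1.
rewrite (_ : equivariant f pi _ =
  respects c f && [forall v, pi (phi v) == phi (quotient_map c f v)]).
  by case: respects; case: [forall v, _].
apply/forallP/andP => [h|[/forallP rc /forallP h] t]; last first.
  rewrite !ffunE (eqP (h _)) qE /=; apply/eqP; congr (phi _); apply/eqP.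
  by rewrite class_proj_eq; apply: rc.
have h' t : pi (phi (class_proj e t)) = phi (class_proj e (f t)).
  by have := h t; rewrite !ffunE => /eqP.
split; last by apply/forallP => v; rewrite qE -h' class_projK.
apply/forallP => t; rewrite -(class_proj_eq e); apply/eqP/inj.
rewrite -!h'; congr (pi (phi _)); apply/eqP; rewrite class_proj_eq.
by rewrite (canon_idem _ e).
Qed.

Definition hom (V : finType) (f : V -> V) n (pi : 'S_n) : nat :=
  (\sum_(h : {ffun V -> 'I_n}) equivariant f pi h)%N.

Definition idf (T : finType) : {ffun T -> T} := [ffun x => x].

Lemma canon_idf (T : finType) : canon (idf T) = idf T.
Proof. by apply/ffunP => t; rewrite -[LHS](ffunE id) -/(idf T) canonK. Qed.

(** The trivial kernel accounts for the injective maps. *)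
Lemma hom_emb (V : finType) (f : V -> V) n (pi : 'S_n) :
  hom f pi = (emb f pi + \sum_(c : {ffun V -> V} | (canon c == c) && (c != idf V))
     respects c f * emb (quotient_map c f) pi)%N.
Proof.
rewrite /hom (partition_big (fun h : {ffun V -> 'I_n} => canon h) (fun c => canon c == c)) /=;
  last by move=> h _; rewrite canon_canon.
rewrite (bigD1 (idf V)) ?canon_idf //=; congr (_ + _)%N; last first.
  by apply: eq_bigr => c /andP[/eqP e _]; rewrite sum_equivariant_kernel.
rewrite sum_equivariant_kernel ?canon_idf //.
have -> : respects (idf V) f by apply/forallP => t; rewrite !ffunE.
rewrite mul1n; apply: (@emb_transport _ _ val).
  have cl x : idf V x == x by rewrite ffunE.
  by exists (fun x => exist _ x (cl x)) => // v; apply: val_inj.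
by move=> v; rewrite val_insubd !ffunE eqxx.
Qed.

Lemma card_classes_lt (V : finType) (c : {ffun V -> V}) :
  c != idf V -> (#|{: classes_of c}| < #|V|)%N.
Proof.
move=> nid; rewrite card_sig; apply: proper_card; apply/properP; split.
  by apply/subsetP.
have [/forallP all|/forallPn[x nx]] := boolP [forall x, c x == x].
  by case/eqP: nid; apply/ffunP => x; rewrite ffunE (eqP (all x)).
by exists x.
Qed.

Lemma permX_porbit (T : finType) (w : {perm T}) x a b :
  (w ^+ a)%g x = (w ^+ b)%g x -> a = b %[mod #|porbit w x|].
Proof.
set l := #|porbit w x|; have l0 : (0 < l)%N by rewrite lt0n card_porbit_neq0.
have red m : (w ^+ m)%g x = iter (m %% l) w x.
  rewrite {1}(divn_eq m l) permX addnC iterD; congr (iter _ w _).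
  by elim: (m %/ l)%N => [|q IH] //; rewrite mulSn iterD IH iter_porbit.
rewrite !red => e; apply/eqP.
have ua : (a %% l < l)%N by rewrite ltn_mod.
have ub : (b %% l < l)%N by rewrite ltn_mod.
have := uniq_traject_porbit w x; rewrite -/l => u.
rewrite -(nth_uniq x _ _ u) ?size_traject // !nth_traject // e.
exact: eqxx.
Qed.

(** * Counting equivariant maps orbit by orbit *)

Definition fix_count n (pi : 'S_n) (l : nat) : nat :=
  #|[set y | (pi ^+ l)%g y == y]|.

Section HomPerm.
Variables (V : finType) (w : {perm V}).
Let r := canon (porbit w).
Let re : canon r = r := canon_canon (porbit w).

(** An equivariant map is determined by the images of the chosen points of the
    orbits of [w]; for an orbit of length l this image can be any fixed point of
    the l-th power of [pi]. *)
Lemma hom_perm n (pi : 'S_n) :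
  hom w pi = (\prod_(v : classes_of r) fix_count pi #|porbit w (val v)|)%N.
Proof.
pose F (v : classes_of r) := [pred y : 'I_n | (pi ^+ #|porbit w (val v)|)%g y == y].
transitivity #|family F|; last first.
  rewrite card_family foldrE big_map big_enum; apply: eq_bigr => v _.
  by rewrite /fix_count cardsE.
have ex_k x : exists k : nat, (w ^+ k)%g (r x) == x.
  have : x \in porbit w (r x).
    by rewrite -eq_porbit_mem /r (canonK (porbit w) x).
  by case/porbitP => i e; exists i; rewrite -e.
(* [k x] is the number of steps from the chosen point of the orbit to [x]. *)
pose k x := xchoose (ex_k x).
have kP x : (w ^+ k x)%g (r x) = x by apply/eqP/(xchooseP (ex_k x)).
have r_w x : r (w x) = r x.
  apply/eqP; rewrite canon_eq eq_porbit_mem -{1}(expg1 w).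
  exact: mem_porbit.
pose restr (h : {ffun V -> 'I_n}) : {ffun classes_of r -> 'I_n} :=
  [ffun v => h (val v)].
have iterE (h : V -> 'I_n) : equivariant w pi h ->
    forall a x, h ((w ^+ a)%g x) = (pi ^+ a)%g (h x).
  move=> /forallP eqv; elim=> [|a IH] x; first by rewrite !expg0 !perm1.
  by rewrite !expgSr !permM -IH (eqP (eqv _)).
have -> : hom w pi = #|[set h : {ffun V -> 'I_n} | equivariant w pi h]|.
  rewrite /hom -sum1_card [RHS]big_mkcond; apply: eq_bigr => h _.
  by rewrite inE; case: equivariant.
have restr_inj : {in [set h : {ffun V -> 'I_n} | equivariant w pi h] &, injective restr}.
  move=> h h'; rewrite !inE => eh eh' /ffunP e; apply/ffunP => x.
  rewrite -(kP x) !iterE //; congr ((_ : 'S_n) _).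
  by have := e (class_proj re x); rewrite [LHS]ffunE [RHS]ffunE.
rewrite -(card_in_imset restr_inj); apply: eq_card => psi.
apply/imsetP/familyP => [[h] + -> v|psiF].
  by rewrite inE => eh; rewrite !inE ffunE -iterE // permX iter_porbit.
pose h := [ffun x => (pi ^+ k x)%g (psi (class_proj re x))].
have hE a x : (pi ^+ a)%g (psi (class_proj re x)) = h ((w ^+ a)%g (r x)).
  rewrite ffunE; set y := (w ^+ a)%g (r x).
  have ry : r y = r x.
    rewrite /y; elim: (a) => [|b IH]; last by rewrite expgSr permM r_w IH.
    by rewrite expg0 perm1 (canon_idem _ re).
  have -> : class_proj re y = class_proj re x.
    by apply/eqP; rewrite class_proj_eq ry.
  have : (w ^+ k y)%g (r x) = y by rewrite -ry kP.
  move/permX_porbit; set l := #|_| => ekl.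
  have per m : (pi ^+ m)%g (psi (class_proj re x)) =
      (pi ^+ (m %% l))%g (psi (class_proj re x)).
    rewrite {1}(divn_eq m l) permX addnC iterD [RHS]permX.
    congr (iter _ pi _); elim: (m %/ l)%N => [|q IH] //.
    rewrite mulSn iterD IH -permX; apply/eqP.
    exact: psiF (class_proj re x).
  by rewrite per -ekl -per.
exists h; last first.
  apply/ffunP => v; rewrite ffunE; have := hE 0%N (val v).
  rewrite !expg0 !perm1 class_projK => ->; congr (h _).
  by apply/eqP/(valP v).
rewrite inE; apply/forallP => x; apply/eqP; rewrite -(kP x) -hE.
by rewrite -!permM -!expgSr -hE.
Qed.
End HomPerm.

(** * Polynomials in the cycle counts *)

Section Polynomial.
Variable N : nat.

Lemma wdeg_le D D' (f : {mpoly rat[N.+1]}) : (D <= D')%N ->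
  weighted_degree_le f D -> weighted_degree_le f D'.
Proof. by move=> le wf m /wf/leq_trans; apply. Qed.

Lemma wdeg_const (a : rat) : weighted_degree_le (a%:MP : {mpoly rat[N.+1]}) 0.
Proof.
move=> m; rewrite msuppC; case: eqP => _; rewrite ?in_nil // inE => /eqP ->.
by rewrite big1 // => i _; rewrite mnm0E.
Qed.

Lemma wdeg_var (i : 'I_N.+1) :
  weighted_degree_le ('X_i : {mpoly rat[N.+1]}) (var_degree i).
Proof.
move=> m; rewrite msuppX inE => /eqP ->.
rewrite (bigD1 i) //= mnm1E eqxx mul1n big1 ?addn0 // => j nj.
by rewrite mnm1E eq_sym (negPf nj).
Qed.

Lemma wdegD D (f g : {mpoly rat[N.+1]}) :
  weighted_degree_le f D -> weighted_degree_le g D -> weighted_degree_le (f + g) D.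
Proof.
by move=> wf wg m /msuppD_le; rewrite mem_cat => /orP[/wf|/wg].
Qed.

Lemma wdegM D1 D2 (f g : {mpoly rat[N.+1]}) :
  weighted_degree_le f D1 -> weighted_degree_le g D2 ->
  weighted_degree_le (f * g) (D1 + D2).
Proof.
move=> wf wg m /msuppM_le/allpairsP[[m1 m2] [/wf h1 /wg h2 ->]] /=.
under eq_bigr do rewrite mnmDE mulnDl.
by rewrite big_split leq_add.
Qed.

Definition cycle_poly D (F : forall n, 'S_n -> rat) : Prop :=
  exists f : {mpoly rat[N.+1]}, weighted_degree_le f D /\
    forall n (pi : 'S_n), F n pi = f.@[cycle_point pi].

Lemma cycle_poly_const a : cycle_poly 0 (fun n pi => a).
Proof.
exists a%:MP; split; first exact: wdeg_const.
by move=> n pi; rewrite mevalC.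
Qed.

Lemma cycle_poly_le D D' F : (D <= D')%N -> cycle_poly D F -> cycle_poly D' F.
Proof. by move=> le [f [wf fE]]; exists f; split => //; apply: wdeg_le wf. Qed.

Lemma cycle_poly_ext D F F' : (forall n pi, F n pi = F' n pi) ->
  cycle_poly D F -> cycle_poly D F'.
Proof. by move=> e [f [wf fE]]; exists f; split => // n pi; rewrite -e. Qed.

Lemma cycle_polyD D F F' : cycle_poly D F -> cycle_poly D F' ->
  cycle_poly D (fun n pi => F n pi + F' n pi).
Proof.
move=> [f [wf fE]] [g [wg gE]]; exists (f + g); split; first exact: wdegD.
by move=> n pi; rewrite mevalD fE gE.
Qed.

Lemma cycle_polyM D D' F F' : cycle_poly D F -> cycle_poly D' F' ->
  cycle_poly (D + D') (fun n pi => F n pi * F' n pi).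
Proof.
move=> [f [wf fE]] [g [wg gE]]; exists (f * g); split; first exact: wdegM.
by move=> n pi; rewrite mevalM fE gE.
Qed.

Lemma cycle_polyZ D a F : cycle_poly D F -> cycle_poly D (fun n pi => a * F n pi).
Proof. by move=> pF; apply: (cycle_polyM (cycle_poly_const a) pF). Qed.

Lemma cycle_poly_sum D (I : Type) (s : seq I) (P : pred I) F :
  (forall i, P i -> cycle_poly D (F i)) ->
  cycle_poly D (fun n pi => \sum_(i <- s | P i) F i n pi).
Proof.
move=> pF; elim: s => [|i s IHs].
  apply: (cycle_poly_le (leq0n D)); apply: cycle_poly_ext (cycle_poly_const 0).
  by move=> n pi; rewrite big_nil.
case Pi: (P i); last by apply: cycle_poly_ext IHs => n pi; rewrite big_cons Pi.
apply: (cycle_poly_ext _ (cycle_polyD (pF i Pi) IHs)) => n pi.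
by rewrite big_cons Pi.
Qed.

Lemma cycle_poly_prod (I : Type) (s : seq I) (deg : I -> nat) F :
  (forall i, cycle_poly (deg i) (F i)) ->
  cycle_poly (\sum_(i <- s) deg i) (fun n pi => \prod_(i <- s) F i n pi).
Proof.
move=> pF; elim: s => [|i s IHs].
  rewrite big_nil; apply: cycle_poly_ext (cycle_poly_const 1).
  by move=> n pi; rewrite big_nil.
rewrite big_cons; apply: (cycle_poly_ext _ (cycle_polyM (pF i) IHs)) => n pi.
by rewrite big_cons.
Qed.

Lemma cycle_poly_size : cycle_poly 1 (fun n pi => n%:R).
Proof.
exists 'X_ord0; split; first exact: wdeg_var.
by move=> n pi; rewrite mevalXU.
Qed.

Lemma cycle_poly_count i : (0 < i <= N)%N ->
  cycle_poly i (fun n pi => (cycle_count i pi)%:R).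
Proof.
case/andP=> i0 iN; have iN' : (i < N.+1)%N by [].
exists 'X_(Ordinal iN'); split; first by have := @wdeg_var (Ordinal iN'); case: (i) i0 iN'.
by move=> n pi; rewrite mevalXU /cycle_point /= -[_ == 0%N]negbK -lt0n i0.
Qed.

End Polynomial.

(** A cycle of length i is fixed pointwise by the powers with exponent divisible
    by i, and the other powers move all its points. *)
Lemma fix_countE n (pi : 'S_n) l : (0 < l)%N ->
  fix_count pi l = (\sum_(i < l.+1 | (0 < i) && (i %| l)) i * cycle_count i pi)%N.
Proof.
move=> l0; rewrite /fix_count.
have fixE y : ((pi ^+ l)%g y == y) = (#|porbit pi y| %| l)%N.
  apply/eqP/idP => [e|/dvdnP[q ->]].
    have := @permX_porbit _ pi y l 0 _.
    by rewrite expg0 perm1 e mod0n => /(_ erefl)/eqP.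
  rewrite permX; elim: q => [|q IH] //.
  by rewrite mulSn iterD IH iter_porbit.
rewrite -sum1_card; under eq_bigl do rewrite inE fixE.
rewrite (partition_big (fun y => inord #|porbit pi y| : 'I_l.+1)
   (fun i : 'I_l.+1 => (0 < i) && (i %| l))%N) /=; last first.
  move=> y dv; rewrite inordK; last by rewrite ltnS dvdn_leq.
  by rewrite dv lt0n card_porbit_neq0.
apply: eq_bigr => i /andP[i0 il].
rewrite (eq_bigl (fun y => #|porbit pi y| == i)); last first.
  move=> y; apply/andP/eqP => [[dv /eqP <-]|->]; last by rewrite il inord_val eqxx.
  by rewrite inordK // ltnS dvdn_leq.
rewrite (partition_big (porbit pi) (fun c => (c \in porbits pi) && (#|c| == i))) /=;
  last by move=> y ->; rewrite imset_f.
rewrite (eq_bigr (fun=> nat_of_ord i)) => [|c /andP[/imsetP[x _ ->] /eqP ci]].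
  by rewrite sum_nat_const mulnC; congr (_ * _)%N; apply: eq_card => c; rewrite !inE.
rewrite -[RHS]ci sum1_card; apply: eq_card => y.
rewrite -eq_porbit_mem [LHS]/in_mem /=.
case: (porbit pi y =P porbit pi x) => [->|_]; last by rewrite andbF.
by rewrite ci eqxx.
Qed.

Lemma sum_porbits (V : finType) (w : {perm V}) :
  (\sum_(v : classes_of (canon (porbit w))) #|porbit w (val v)|)%N = #|V|.
Proof.
pose re := canon_canon (porbit w).
rewrite -sum1_card (partition_big (class_proj re) predT) //=.
apply: eq_bigr => v _; rewrite sum1_card; apply: eq_card => x.
change ((x \in porbit w (val v)) = (class_proj re x == v)).
rewrite -{2}(class_projK re v) class_proj_eq canon_eq.
by rewrite eq_porbit_mem.
Qed.

(** Embeddings are the equivariant maps that are not embeddings of a proper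
    quotient; the former are counted by a product over the orbits of [f], in
    which an orbit of length l contributes degree l. *)
Lemma cycle_poly_emb N (V : finType) (f : V -> V) : (#|V| <= N)%N ->
  cycle_poly N #|V| (fun n pi => (emb f pi)%:R).
Proof.
have [s le_s] := ubnP #|V|; elim: s => // s IHs in V f le_s * => VN.
have [/injectiveP fi|nf] := boolP (injectiveb f); last first.
  apply: (cycle_poly_le (leq0n _)); apply: cycle_poly_ext (cycle_poly_const N 0).
  by move=> n pi; rewrite emb_noninj.
have pquot c : c != idf V -> cycle_poly N #|V|
    (fun n pi => (respects c f * emb (quotient_map c f) pi)%N%:R).
  move=> nc; have lt := card_classes_lt nc.
  apply: (cycle_poly_le (ltnW lt)).
  apply: (cycle_poly_ext _ (cycle_polyZ (respects c f)%:R (IHs _ (quotient_map c f) _ _))).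
  - by move=> n pi; rewrite natrM.
  - exact: leq_trans lt _.
  - exact: leq_trans (ltnW lt) VN.
have phom : cycle_poly N #|V| (fun n pi => (hom f pi)%:R).
  pose w := perm fi.
  have pfix l : (0 < l <= N)%N -> cycle_poly N l (fun n pi => (fix_count pi l)%:R).
    case/andP=> l0 lN.
    apply: (cycle_poly_ext _ (@cycle_poly_sum _ _ _ (index_enum 'I_l.+1)
      (fun i : 'I_l.+1 => (0 < i) && (i %| l))%N
      (fun i n pi => (i * cycle_count i pi)%N%:R) _)).
      by move=> n pi; rewrite fix_countE // natr_sum.
    move=> i /andP[i0 _]; have il : (i <= l)%N by rewrite -ltnS.
    apply: (cycle_poly_le il).
    apply: cycle_poly_ext (cycle_polyZ i%:R (@cycle_poly_count N i _)).
      by move=> n pi; rewrite natrM.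
    by rewrite i0 (leq_trans il).
  rewrite -(sum_porbits w).
  apply: (cycle_poly_ext _ (@cycle_poly_prod _ _ _ (fun v => #|porbit w (val v)|)
    (fun v n pi => (fix_count pi #|porbit w (val v)|)%:R) _)) => [n pi|v] /=.
    rewrite -natr_prod -hom_perm; congr (_%:R); apply: eq_bigr => h _.
    by congr (nat_of_bool _); apply: eq_forallb => v; rewrite permE.
  apply: pfix; rewrite lt0n card_porbit_neq0 /=.
  exact: leq_trans (max_card _) VN.
have psum : cycle_poly N #|V| (fun n pi =>
    \sum_(c : {ffun V -> V} | (canon c == c) && (c != idf V))
      (respects c f * emb (quotient_map c f) pi)%N%:R).
  by apply: cycle_poly_sum => c /andP[_]; exact: pquot.
apply: (cycle_poly_ext _ (cycle_polyD phom (cycle_polyZ (-1) psum))) => n pi.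
by rewrite hom_emb natrD natr_sum mulN1r addrK.
Qed.

Lemma cycle_poly_span N D F : emb_span D F -> (D <= N)%N -> cycle_poly N D F.
Proof.
elim=> {D F} [m w|D F1 F2 _ IH1 _ IH2|D a F _ IH|D F _ IH|D D' F le _ IH|D F F' e _ IH] DN.
- by have := @cycle_poly_emb N _ w; rewrite card_ord; apply.
- by apply: cycle_polyD; [apply: IH1 | apply: IH2].
- by apply: cycle_polyZ; apply: IH.
- by rewrite -add1n; apply: cycle_polyM (cycle_poly_size N) (IH (ltnW DN)).
- exact: cycle_poly_le le (IH (leq_trans le DN)).
- exact: cycle_poly_ext e (IH DN).
Qed.

(** [emb w] is a polynomial in the cycle counts, hence equal at [pi] and at [w],
    where it is positive; and an embedding of [w] in [pi] on equally many points
    is a permutation that conjugates [w] to [pi]. *)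
Lemma same_cycles_conjugate n (w pi : 'S_n) :
  (forall i, (0 < i <= n)%N -> cycle_count i w = cycle_count i pi) ->
  pi \in (w ^: [set: 'S_n])%g.
Proof.
move=> cc; have [|f [_ fE]] := @cycle_poly_emb n 'I_n w; first by rewrite card_ord.
have e_ww : (0 < emb w w)%N.
  apply/card_gt0P; exists [ffun i => i]; rewrite inE; apply/andP; split.
    by apply/injectiveP => i j; rewrite !ffunE.
  by apply/forallP => i; rewrite !ffunE.
have : (0 < emb w pi)%N.
  rewrite -(ltr0n rat) fE (_ : f.@[cycle_point pi] = f.@[cycle_point w]).
    by rewrite -fE ltr0n.
  apply: meval_eq => i; rewrite /cycle_point.
  case: eqP => // /eqP; rewrite -lt0n => i0; congr (_%:R); rewrite cc // i0.
  by rewrite -ltnS ltn_ord.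
case/card_gt0P => phi; rewrite inE => /andP[/injectiveP inj /forallP eqv].
apply/imsetP; exists (perm inj); rewrite ?inE //; apply/permP => x.
rewrite conjgE !permM -{1}(permKV (perm inj) x).
by move: ((perm inj)^-1 x)%g => y; rewrite !permE (eqP (eqv y)).
Qed.

(** * Right ideals of a group algebra *)

(** [P] is a projection onto the module [U]. *)
Lemma mxtrace_submod (F : fieldType) m (U P B : 'M[F]_m) :
  (P <= U)%MS -> U *m P = U -> (U *m B <= U)%MS ->
  \tr (in_submod U (val_submod 1%:M *m B)) = \tr (P *m B).
Proof.
move=> PU UP UB; set rb : 'M_(_, m) := val_submod 1%:M.
have rbU : (rb <= U)%MS by rewrite val_submod1.
have rbP : rb *m P = rb.
  have /submxP[D ->] := rbU; by rewrite -mulmxA UP.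
pose Q := in_submod U P; have PQ : P = Q *m rb by rewrite -val_submodE in_submodK.
have rbQ : rb *m Q = 1%:M.
  by rewrite /Q in_submodE mulmxA rbP -in_submodE val_submodK.
have rbB : (rb *m B <= U)%MS.
  by apply: submx_trans UB; rewrite submxMr.
have eX : in_submod U (rb *m B) = (rb *m B) *m Q.
  by rewrite -{2}(in_submodK rbB) val_submodE -/rb -mulmxA rbQ mulmx1.
by rewrite eX mxtrace_mulC mulmxA -PQ.
Qed.

Section GroupAlgebra.
Variable gT : finGroupType.
Local Notation G := [set: gT]%G.
Local Notation aG := (regular_repr algC G).
Local Notation E_G := (enveloping_algebra_mx aG).

Lemma aGM x y : aG (x * y)%g = aG x *m aG y.
Proof. by rewrite repr_mxM ?inE. Qed.

Lemma mxtrace_regular x : \tr (aG x) = #|gT|%:R *+ (x == 1%g) :> algC.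
Proof.
have /cfunP/(_ x) := cfReprReg G; rewrite cfRegE cfunE inE mulr1n => ->.
by rewrite cardsT.
Qed.

(** In the regular representation only the identity has nonzero trace, so traces
    extract the coefficients of an element of the group algebra. *)
Lemma mxtrace_coef (f : gT -> algC) x :
  \tr ((\sum_y f y *: aG y) *m aG x^-1%g) = #|gT|%:R * f x.
Proof.
rewrite mulmx_suml raddf_sum /= (bigD1 x) //= big1 ?addr0 => [|y nyx].
  by rewrite -scalemxAl -aGM mulgV mxtraceZ mxtrace_regular eqxx mulr1n mulrC.
by rewrite -scalemxAl -aGM mxtraceZ mxtrace_regular -eq_mulgV1 (negPf nyx) mulr0.
Qed.

Lemma envelopP A : (A \in E_G)%MS -> A = \sum_y (\tr (A *m aG y^-1%g) / #|gT|%:R) *: aG y.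
Proof.
case/envelop_mxP => f fE; have {}fE : A = \sum_y f y *: aG y.
  by rewrite fE; apply: eq_bigl => x; rewrite inE.
have g0 : #|gT|%:R != 0 :> algC.
  by rewrite pnatr_eq0 -cardsT -lt0n cardG_gt0.
rewrite [LHS]fE; apply: eq_bigr => y _; congr (_ *: _).
by rewrite fE mxtrace_coef mulrC mulKf.
Qed.

Lemma gring_rowE (f : gT -> algC) y :
  gring_row (\sum_x f x *: aG x) 0 (gring_index G y) = f y.
Proof.
rewrite linear_sum summxE (bigD1 y) //= big1 ?addr0 => [|x nxy].
  by rewrite linearZ /= /gring_row rowK gring_indexK ?group1 // mul1g !mxE !eqxx mulr1.
rewrite linearZ /= /gring_row rowK gring_indexK ?group1 // mul1g !mxE /=.
by rewrite (can_in_eq (@gring_indexK _ G)) ?inE // eq_sym (negPf nxy) mulr0.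
Qed.

Lemma gring_mx_row A : (A \in E_G)%MS -> gring_mx aG (gring_row A) = A.
Proof.
move/envelop_mxP => [f ->]; rewrite 2!linear_sum; apply: eq_bigr => x Gx.
by rewrite 2!linearZ /= -gring_opE gring_opG.
Qed.

(** Left multiplication by the idempotent gamma^-1 M is a projection onto the
    right ideal generated by [M]. The trace of this projection followed by right
    multiplication by [g] is the sum over [x] of the coefficient of [x] in
    gamma^-1 M x g, and these coefficients are traces. *)
Lemma quasi_idempotent_char (M : 'M[algC]_#|G|) (gamma : algC) (g : gT) :
  (M \in E_G)%MS -> gamma != 0 -> M *m M = gamma *: M ->
  cfRepr (submod_repr (cyclic_mx_module aG (gring_row M))) g =
  (gamma * #|gT|%:R)^-1 * \sum_x \tr (M *m aG (x * g * x^-1)%g).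
Proof.
move=> ME gam0 MM; rewrite cfunE inE mulr1n /= /submod_mx.
set u := gring_row M; set U := cyclic_mx aG u.
(* Left multiplication by gamma^-1 M, acting on row vectors. *)
pose P : 'M[algC]_#|G| := \matrix_(i < #|G|) (gamma^-1 *: (u *m aG (enum_val i))).
have mulP m (v : 'M_(m, #|G|)) : (forall i, (row i v *m P = row i v)) -> v *m P = v.
  by move=> e; apply/row_matrixP => i; rewrite row_mul e.
have vP (v : 'rV_#|G|) : v *m P = gamma^-1 *: (u *m gring_mx aG v).
  rewrite mulmx_sum_row /gring_mx /= [v *m enveloping_algebra_mx _]mulmx_sum_row.
  rewrite linear_sum mulmx_sumr scaler_sumr.
  apply: eq_bigr => i _; rewrite !rowK !linearZ /= mxvecK.
  by rewrite !scalerA mulrC.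
rewrite (@mxtrace_submod _ _ U P).
- rewrite {1}/mxtrace.
  have [f Mf] := envelop_mxP ME.
  have {}Mf : M = \sum_y f y *: aG y by rewrite Mf; apply: eq_bigl => x; rewrite inE.
  have coefE y : \tr (M *m aG y) = #|gT|%:R * f (y^-1)%g.
    by rewrite Mf -[aG y]/(aG y) -{1}(invgK y); exact: mxtrace_coef.
  rewrite invfM -mulrA mulr_sumr mulr_sumr.
  rewrite (reindex (gring_index G)) /=; last first.
    by exists enum_val => i _; rewrite ?gring_indexK ?inE // gring_valK.
  apply: eq_bigr => x _.
  rewrite coefE mulKf; last first.
    by rewrite pnatr_eq0 -cardsT -lt0n cardG_gt0.
  transitivity ((row (gring_index G x) P *m aG g) 0 (gring_index G x)).
    by rewrite -row_mul [RHS]mxE.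
  rewrite rowK gring_indexK ?inE // -scalemxAl mxE -mulmxA -aGM; congr (_ * _).
  rewrite /u -gring_row_mul {1}Mf mulmx_suml.
  rewrite (reindex (fun y => y * (x * g)^-1)%g) /=; last first.
    by exists (fun y => y * (x * g))%g => y _; rewrite ?mulgKV ?mulgK.
  under eq_bigr do rewrite -scalemxAl -aGM mulgKV.
  by rewrite (gring_rowE (fun y => f (y * (x * g)^-1)%g)) !invMg invgK.
- apply/row_subP => i; rewrite rowK scalemx_sub //.
  apply: mxmodule_trans (cyclic_mx_module aG u) _ (cyclic_mx_id aG u).
  by rewrite inE.
- apply: mulP => i.
  have /cyclic_mxP[A AE ->] := row_sub i U.
  rewrite vP -[u *m A]gring_row_mul gring_mx_row ?envelop_mxM //.
  by rewrite -gring_row_mul mulmxA MM -scalemxAl linearZ scalerA mulVf ?scale1r.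
- by apply: (mxmoduleP (cyclic_mx_module aG u)); rewrite inE.
Qed.

End GroupAlgebra.

(** * Young diagrams *)

Section Diagram.
Variables (n : nat) (mu : seq nat).
Hypotheses (mu_part : is_partition mu) (mu_n : sumn mu = n).
Implicit Types (i j : 'I_n).

Lemma cell_eq i j : reshape_index mu i = reshape_index mu j ->
  reshape_offset mu i = reshape_offset mu j -> i = j.
Proof.
move=> er eo; apply: val_inj => /=.
by rewrite -(reshape_indexK mu i) -(reshape_indexK mu j) er eo.
Qed.

Lemma cell_exists r c : (c < nth 0 mu r)%N ->
  exists i, reshape_index mu i = r /\ reshape_offset mu i = c.
Proof.
move=> cr; have lt : (flatten_index mu r c < n)%N by rewrite -mu_n flatten_indexP.
by exists (Ordinal lt); rewrite /= flatten_indexKl // flatten_indexKr.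
Qed.

Lemma cell_bound i : (reshape_offset mu i < nth 0 mu (reshape_index mu i))%N.
Proof. by apply: reshape_offsetP; rewrite mu_n. Qed.

Lemma partition_nth r s : (r <= s)%N -> (nth 0 mu s <= nth 0 mu r)%N.
Proof.
move=> rs; have [ss|/leq_trans] := ltnP s (size mu); last first.
  by move=> h; rewrite nth_default // h.
case/andP: mu_part => srt _.
have gt : transitive geq by move=> a b c ab bc; apply: leq_trans bc ab.
by apply: (sorted_leq_nth gt leqnn 0%N srt) => //; rewrite inE (leq_ltn_trans rs).
Qed.

Lemma sumn_take_le r s : (r <= s)%N -> (sumn (take r mu) <= sumn (take s mu))%N.
Proof.
move=> rs; rewrite -(subnKC rs) takeD sumn_cat leq_addr //.
Qed.

Lemma row_ltn i r : (reshape_index mu i < r)%N = (i < sumn (take r mu))%N.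
Proof.
have iE : val i = (sumn (take (reshape_index mu i) mu) + reshape_offset mu i)%N.
  by rewrite -[LHS](reshape_indexK mu i).
have [lt|ge] := ltnP (reshape_index mu i) r; apply/esym.
  apply: leq_trans (sumn_take_le lt); rewrite [X in (X < _)%N]iE.
  have sz : (reshape_index mu i < size mu)%N by apply: reshape_indexP; rewrite mu_n.
  by rewrite (take_nth 0%N sz) sumn_rcons ltn_add2l cell_bound.
apply/negbTE; rewrite -leqNgt [X in (_ <= X)%N]iE; apply: leq_trans (leq_addr _ _).
exact: sumn_take_le.
Qed.

Lemma card_rows r :
  #|[set i : 'I_n | (reshape_index mu i < r)%N]| = sumn (take r mu).
Proof.
rewrite -sum1_card; under eq_bigl do rewrite inE row_ltn.
rewrite -(big_ord_widen n (fun=> 1%N)) ?sum1_card ?card_ord //.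
by rewrite -mu_n -{2}(cat_take_drop r mu) sumn_cat leq_addr.
Qed.

(** The row lengths decrease, so columns have no gaps. *)
Lemma column_up i r : (r <= reshape_index mu i)%N ->
  exists j, reshape_index mu j = r /\ reshape_offset mu j = reshape_offset mu i.
Proof.
move=> le; apply: cell_exists; apply: leq_trans (cell_bound i) _.
exact: partition_nth.
Qed.

(** The points of [A] lie in column [c] and have distinct labels below [r], so
    that their number is at most [r] and at most the height of the column; the
    first [r] rows of the column attain the smaller of these bounds. *)
Lemma card_column_le (A : {set 'I_n}) (f : 'I_n -> nat) r c :
  (forall i, i \in A -> (f i < r)%N /\ reshape_offset mu i = c) ->
  {in A &, injective f} ->
  (#|A| <= #|[set j : 'I_n | (reshape_index mu j < r)%N & reshape_offset mu j == c]|)%N.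
Proof.
move=> hA inj; set B := [set j | _ & _].
have [/existsP[j /andP[/eqP cj rj]]|/existsPn none] :=
    boolP [exists j : 'I_n, (reshape_offset mu j == c) && (r <= reshape_index mu j)%N].
  have sA : (#|A| <= r)%N.
    (* The labels below [r], in the inhabited type 'I_r.+1, miss [ord_max]. *)
    pose g i : 'I_r.+1 := inord (f i).
    have ig : {in A &, injective g}.
      move=> i i' iA i'A /(congr1 val); rewrite /= !inordK; first exact: inj.
        by apply: ltnW; case: (hA i').
      by apply: ltnW; case: (hA i).
    have cr : #|predC1 (ord_max : 'I_r.+1)| = r by rewrite cardC1 card_ord.
    rewrite -(card_in_imset ig) -[X in (_ <= X)%N]cr.
    apply/subset_leq_card/subsetP => y.
    case/imsetP => i /hA[lt _] ->; rewrite !inE -val_eqE /= inordK ?ltnS ?(ltnW lt) //.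
    by rewrite neq_ltn lt.
  apply: leq_trans sA _.
  have ex (s : 'I_r) : {j' : 'I_n | (reshape_index mu j' == s) && (reshape_offset mu j' == c)}.
    apply/sigW; have [|j' [e1 e2]] := @column_up j s.
      exact: ltnW (leq_trans (ltn_ord s) rj).
    by exists j'; rewrite e1 e2 cj !eqxx.
  pose g s := sval (ex s).
  have gP s : reshape_index mu (g s) = s /\ reshape_offset mu (g s) = c.
    by have /andP[/eqP ? /eqP ?] := svalP (ex s).
  have ig : injective g.
    by move=> s t e; apply: val_inj; rewrite /= -(gP s).1 -(gP t).1 e.
  rewrite -{1}(card_ord r) -(card_imset _ ig); apply/subset_leq_card/subsetP => y.
  by case/imsetP => s _ ->; rewrite inE (gP s).1 (gP s).2 ltn_ord eqxx.
apply/subset_leq_card/subsetP => i iA; rewrite inE.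
have [_ ci] := hA i iA; rewrite ci eqxx andbT ltnNge.
by have := none i; rewrite ci eqxx.
Qed.
End Diagram.

Lemma nth_le_sumn (s : seq nat) r : (nth 0 s r <= sumn s)%N.
Proof.
elim: s r => [|m s IH] [|r] //=; first exact: leq_addr.
exact: leq_trans (IH r) (leq_addl _ _).
Qed.

Lemma sum_eq_leq (I : finType) (f g : I -> nat) : (forall i, f i <= g i)%N ->
  (\sum_i f i = \sum_i g i)%N -> forall i, f i = g i.
Proof.
move=> le e i; apply/eqP; rewrite eqn_leq le /=.
have : (\sum_(j | j != i) f j <= \sum_(j | j != i) g j)%N by apply: leq_sum.
by move: e; rewrite (bigD1 i) // [in RHS](bigD1 i) //=; lia.
Qed.

(** * The dominance order *)

Section Dominance.
Variables (n : nat) (lam mu : seq nat).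
Hypotheses (lam_n : sumn lam = n) (mu_part : is_partition mu) (mu_n : sumn mu = n).
Variable x : 'S_n.
Hypothesis spread : forall i j : 'I_n,
  reshape_index lam (x i) = reshape_index lam (x j) ->
  reshape_offset mu i = reshape_offset mu j -> i = j.

Let in_col r c := [set i : 'I_n | (reshape_index lam (x i) < r)%N & reshape_offset mu i == c].
Let col r c := [set i : 'I_n | (reshape_index mu i < r)%N & reshape_offset mu i == c].

Lemma card_in_col r c : (#|in_col r c| <= #|col r c|)%N.
Proof.
apply: (@card_column_le n mu mu_part mu_n _ (fun i => reshape_index lam (x i))).
  by move=> i; rewrite inE => /andP[-> /eqP].
move=> i j; rewrite !inE => /andP[_ /eqP ci] /andP[_ /eqP cj] e.
by apply: spread => //; rewrite ci cj.
Qed.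

Lemma offset_lt (i : 'I_n) : (reshape_offset mu i < n)%N.
Proof.
apply: leq_trans (cell_bound mu_n i) _; rewrite -[X in (_ <= X)%N]mu_n.
exact: nth_le_sumn.
Qed.

Lemma sum_columns (A : pred 'I_n) :
  #|[set i | A i]| = (\sum_(c < n) #|[set i | A i & reshape_offset mu i == c]|)%N.
Proof.
rewrite -sum1_card (partition_big (fun i => Ordinal (offset_lt i)) predT) //=.
by apply: eq_bigr => c _; rewrite -sum1_card; apply: eq_bigl => i; rewrite !inE.
Qed.

Lemma card_in_rows r : #|[set i : 'I_n | (reshape_index lam (x i) < r)%N]| = sumn (take r lam).
Proof.
rewrite -(card_rows lam_n) -[RHS](card_preimset _ (@perm_inj _ x)).
by apply: eq_card => i; rewrite !inE.
Qed.

(** The points sent into the first [r] rows of [lam] are, column by column of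
    [mu], at most as many as the points in the first [r] rows of [mu]. *)
Lemma spread_dominance r : (sumn (take r lam) <= sumn (take r mu))%N.
Proof.
rewrite -card_in_rows -(card_rows mu_n) !sum_columns.
by apply: leq_sum => c _; apply: card_in_col.
Qed.

Hypothesis same_shape : lam = mu.

(** For equal shapes both sides of the column counts have the same sum, hence
    agree in each column. If the column of [i] did not reach the row of [x i],
    it would lie entirely in the rows before that one, whereas [i] is not sent
    to these rows. *)
Lemma spread_cell (i : 'I_n) : exists j : 'I_n,
  reshape_index mu j = reshape_index mu (x i) /\ reshape_offset mu j = reshape_offset mu i.
Proof.
apply: (cell_exists mu_n); rewrite ltnNge; apply/negP => le.
pose c := Ordinal (offset_lt i); pose r := reshape_index mu (x i).
have eq_col : #|in_col r c| = #|col r c|.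
  apply: (@sum_eq_leq _ (fun c : 'I_n => #|in_col r c|) (fun c => #|col r c|)).
    by move=> c'; apply: card_in_col.
  by rewrite -!sum_columns card_in_rows (card_rows mu_n) same_shape.
have full : col r c = [set j : 'I_n | reshape_offset mu j == c].
  apply/setP => j; rewrite !inE andb_idl // => /eqP cj; rewrite ltnNge.
  apply/negP => rj; have := leq_trans (cell_bound mu_n j) (partition_nth mu_part rj).
  by rewrite cj ltnNge le.
have : (#|in_col r c| < #|col r c|)%N.
  rewrite full; apply: proper_card; apply/properP; split.
    by apply/subsetP => j; rewrite !inE => /andP[].
  by exists i; rewrite !inE ?eqxx //= same_shape ltnn.
by rewrite eq_col ltnn.
Qed.

(** [q] moves each point within its column to the row of its image under [x]. *)
Lemma spread_factor : exists p q : 'S_n,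
  [/\ p \in row_stab n mu, q \in col_stab n mu & x = (q * p)%g].
Proof.
have ex i : {j : 'I_n | (reshape_index mu j == reshape_index mu (x i)) &&
   (reshape_offset mu j == reshape_offset mu i)}.
  by apply/sigW; have [j [e1 e2]] := spread_cell i; exists j; rewrite e1 e2 !eqxx.
pose q i := sval (ex i).
have qP i : reshape_index mu (q i) = reshape_index mu (x i) /\
    reshape_offset mu (q i) = reshape_offset mu i.
  by have /andP[/eqP ? /eqP ?] := svalP (ex i).
have q_inj : injective q.
  move=> i j e; apply: spread; last by rewrite -(qP i).2 -(qP j).2 e.
  by rewrite same_shape -(qP i).1 -(qP j).1 e.
exists ((perm q_inj)^-1 * x)%g, (perm q_inj); split; last by rewrite mulKVg.
  rewrite inE; apply/forallP => y; rewrite permM.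
  by rewrite -{2}(permKV (perm q_inj) y) permE (qP _).1.
by rewrite inE; apply/forallP => y; rewrite permE (qP _).2.
Qed.

End Dominance.

Definition dominated (lam mu : seq nat) : Prop :=
  forall r, (sumn (take r lam) <= sumn (take r mu))%N.

Lemma dominated_anti lam mu : is_partition lam -> is_partition mu ->
  dominated lam mu -> dominated mu lam -> lam = mu.
Proof.
move=> /andP[_ lam0] /andP[_ mu0] dlm dml.
have e r : sumn (take r lam) = sumn (take r mu) by apply/eqP; rewrite eqn_leq dlm dml.
have take_nthS (s : seq nat) r : sumn (take r.+1 s) = (sumn (take r s) + nth 0 s r)%N.
  have [lt|ge] := ltnP r (size s); first by rewrite (take_nth 0%N lt) sumn_rcons.
  by rewrite !take_oversize ?nth_default ?addn0 // ltnW.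
have en r : nth 0%N lam r = nth 0%N mu r.
  by have := e r.+1; rewrite !take_nthS e => /addnI.
have size_le s1 s2 : 0%N \notin s2 -> (forall r, nth 0%N s1 r = nth 0%N s2 r) ->
    (size s2 <= size s1)%N.
  move=> n0 es; rewrite leqNgt; apply/negP => lt; case/negP: n0.
  by rewrite -(nth_default 0%N (leqnn (size s1))) es mem_nth.
apply: (@eq_from_nth _ 0%N) => //.
by apply/eqP; rewrite eqn_leq !size_le.
Qed.

(** * Young symmetrizers *)

Section YoungSymmetrizer.
Variable n : nat.
Local Notation G := [set: 'S_n]%G.
Local Notation aG := (regular_repr algC G).
Local Notation E_G := (enveloping_algebra_mx aG).
Implicit Types (mu lam : seq nat) (x p q : 'S_n).

Definition row_sum mu : 'M[algC]_#|G| := \sum_(p in row_stab n mu) aG p.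
Definition col_sum mu : 'M[algC]_#|G| := \sum_(q in col_stab n mu) (-1) ^+ q *: aG q.
Definition young_mx mu := row_sum mu *m col_sum mu.

Lemma row_stabP mu p : reflect (forall i : 'I_n, reshape_index mu (p i) = reshape_index mu i)
  (p \in row_stab n mu).
Proof. by rewrite inE; apply: 'forall_eqP. Qed.

Lemma col_stabP mu q : reflect (forall i : 'I_n, reshape_offset mu (q i) = reshape_offset mu i)
  (q \in col_stab n mu).
Proof. by rewrite inE; apply: 'forall_eqP. Qed.

Lemma row_stab_group mu : group_set (row_stab n mu).
Proof.
apply/group_setP; split; first by apply/row_stabP => i; rewrite perm1.
move=> p q /row_stabP hp /row_stabP hq; apply/row_stabP => i.
by rewrite permM hq hp.
Qed.
Canonical row_stab_group_struct mu := Group (row_stab_group mu).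

Lemma col_stab_group mu : group_set (col_stab n mu).
Proof.
apply/group_setP; split; first by apply/col_stabP => i; rewrite perm1.
move=> p q /col_stabP hp /col_stabP hq; apply/col_stabP => i.
by rewrite permM hq hp.
Qed.
Canonical col_stab_group_struct mu := Group (col_stab_group mu).

Lemma young_symmetrizerE mu : young_symmetrizer n mu = gring_row (young_mx mu).
Proof.
rewrite /young_symmetrizer /young_mx /row_sum mulmx_suml linear_sum.
apply: eq_bigr => p _; rewrite mulmx_sumr linear_sum; apply: eq_bigr => q _.
rewrite -scalemxAr linearZ /= -aGM /gring_row rowK gring_indexK ?inE //.
by rewrite mul1g.
Qed.

Lemma row_sum_env mu : (row_sum mu \in E_G)%MS.
Proof.
rewrite /row_sum linear_sum summx_sub // => p _; apply: envelop_mx_id.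
by rewrite inE.
Qed.

Lemma col_sum_env mu : (col_sum mu \in E_G)%MS.
Proof.
rewrite /col_sum linear_sum summx_sub // => p _; rewrite linearZ scalemx_sub //.
by apply: envelop_mx_id; rewrite inE.
Qed.

Lemma row_sum_absorb mu p : p \in row_stab n mu -> aG p *m row_sum mu = row_sum mu.
Proof.
move=> pR; rewrite /row_sum mulmx_sumr [RHS](reindex_inj (mulgI p)) /=.
apply: eq_big => [q|q _]; first by rewrite groupMl.
by rewrite aGM.
Qed.

Lemma col_sum_absorb mu q : q \in col_stab n mu ->
  col_sum mu *m aG q = (-1) ^+ q *: col_sum mu.
Proof.
move=> qC; rewrite /col_sum mulmx_suml scaler_sumr [RHS](reindex_inj (mulIg q)) /=.
apply: eq_big => [s|s _]; first by rewrite groupMr.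
rewrite -scalemxAl scalerA odd_permM signr_addb -aGM mulrCA -expr2 sqrr_sign mulr1.
by [].
Qed.

Lemma aG_tr x : (aG x)^T = aG x^-1%g.
Proof.
apply/matrixP => i j; rewrite !mxE !eqxx /=; congr (_%:R); congr (nat_of_bool _).
apply/eqP/eqP => ->.
  by rewrite gring_indexK ?inE // mulgK gring_valK.
by rewrite gring_indexK ?inE // mulgKV gring_valK.
Qed.

Lemma mulmx_sandwich (A B : 'M[algC]_#|G|) (I : finType) (P : pred I)
    (f : I -> algC) (X : I -> 'M[algC]_#|G|) :
  A *m (\sum_(i | P i) f i *: X i) *m B = \sum_(i | P i) f i *: (A *m X i *m B).
Proof.
rewrite mulmx_sumr mulmx_suml; apply: eq_bigr => i _.
by rewrite -scalemxAr -scalemxAl.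
Qed.

Lemma row_sum_tr mu : (row_sum mu)^T = row_sum mu.
Proof.
rewrite /row_sum linear_sum [RHS](reindex_inj invg_inj) /=.
by apply: eq_big => [p|p _]; [rewrite groupV | apply: aG_tr].
Qed.

Lemma col_sum_tr mu : (col_sum mu)^T = col_sum mu.
Proof.
rewrite /col_sum linear_sum [RHS](reindex_inj invg_inj) /=.
apply: eq_big => [p|p _]; first by rewrite groupV.
by rewrite linearZ /= aG_tr odd_permV.
Qed.

Lemma young_mx_tr mu : (young_mx mu)^T = col_sum mu *m row_sum mu.
Proof. by rewrite trmx_mul row_sum_tr col_sum_tr. Qed.

Lemma row_sum_sq mu : row_sum mu *m row_sum mu = #|row_stab n mu|%:R *: row_sum mu.
Proof.
rewrite {1}/row_sum mulmx_suml (eq_bigr (fun=> row_sum mu)); last first.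
  by move=> p; apply: row_sum_absorb.
by rewrite sumr_const scaler_nat.
Qed.

Lemma col_sum_sq mu : col_sum mu *m col_sum mu = #|col_stab n mu|%:R *: col_sum mu.
Proof.
rewrite {2}/col_sum mulmx_sumr (eq_bigr (fun=> col_sum mu)); last first.
  move=> q qC; rewrite -scalemxAr col_sum_absorb // scalerA -expr2 sqrr_sign.
  by rewrite scale1r.
by rewrite sumr_const scaler_nat.
Qed.

(** The transposition of [i] and [j] changes the sign of the column sum, while
    its conjugate by [x] permutes [S]. *)
Lemma col_sum_vanish mu x (S : {set 'S_n}) (i j : 'I_n) : i != j ->
  reshape_offset mu i = reshape_offset mu j ->
  (forall s, s \in S -> (tperm (x i) (x j) * s)%g \in S) ->
  col_sum mu *m aG x *m (\sum_(s in S) aG s) = 0.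
Proof.
move=> nij cij Sclosed; set Z := _ *m _.
pose t := tperm i j; pose t' := tperm (x i) (x j).
have tC : t \in col_stab n mu.
  by apply/col_stabP => k; rewrite /t; case: tpermP => [->|->|].
have t'S : aG t' *m (\sum_(s in S) aG s) = \sum_(s in S) aG s.
  rewrite mulmx_sumr [RHS](reindex_inj (mulgI t')) /=.
  apply: eq_big => [s|s _]; last by rewrite aGM.
  apply/idP/idP => [/Sclosed //|/Sclosed]; by rewrite mulgA tperm2 mul1g.
have tx : aG t *m aG x = aG x *m aG t'.
  by rewrite -!aGM; congr (aG _); rewrite /t' -tpermJ conjgE !mulgA mulgV mul1g.
(* Insert the transposition between [col_sum mu] and [aG x]. *)
have : Z = - Z.
  rewrite {1}/Z -t'S mulmxA -(mulmxA (col_sum mu)) -tx !mulmxA col_sum_absorb //.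
  by rewrite /t odd_tperm nij expr1 scaleN1r !mulNmx.
move/eqP; rewrite -addr_eq0 -mulr2n -scaler_nat scaler_eq0 pnatr_eq0 /=.
by move/eqP.
Qed.

(** Either two points of a column of [mu] are sent to the same row of [lam], and
    their transposition kills the product, or there are none. *)
Lemma col_row_sum_cases lam mu x :
  col_sum mu *m aG x *m row_sum lam = 0 \/
  (forall i j : 'I_n, reshape_index lam (x i) = reshape_index lam (x j) ->
     reshape_offset mu i = reshape_offset mu j -> i = j).
Proof.
have [/forallP h|/forallPn[i /forallPn[j]]] := boolP [forall i : 'I_n, forall j : 'I_n,
    (reshape_index lam (x i) == reshape_index lam (x j)) &&
    (reshape_offset mu i == reshape_offset mu j) ==> (i == j)].
  right=> i j ri cj; apply/eqP; have /forallP/(_ j) := h i.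
  by rewrite ri cj !eqxx.
rewrite negb_imply => /andP[/andP[/eqP rij /eqP cij] nij]; left.
apply: (col_sum_vanish nij cij) => s /row_stabP sR; apply/row_stabP => k.
by rewrite permM sR; case: tpermP => [->|->|].
Qed.

Lemma col_row_sum_dominated lam mu x : is_partition mu ->
  sumn lam = n -> sumn mu = n ->
  col_sum mu *m aG x *m row_sum lam != 0 -> dominated lam mu.
Proof.
move=> pm nl nm nz; case: (col_row_sum_cases lam mu x) => [/eqP|sp].
  by rewrite (negPf nz).
exact: (spread_dominance nl pm nm sp).
Qed.

Section OneShape.
Variable mu : seq nat.
Hypotheses (mu_part : is_partition mu) (mu_n : sumn mu = n).
Local Notation a := (row_sum mu).
Local Notation b := (col_sum mu).
Local Notation c := (young_mx mu).

(** Total in [x], so that it extends to a linear form on the group algebra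
    ([factor_sign_lin]). *)
Definition factor_sign x : algC :=
  if [pick pq : 'S_n * 'S_n | [&& pq.1 \in row_stab n mu, pq.2 \in col_stab n mu
        & x == (pq.2 * pq.1)%g]] is Some pq then (-1) ^+ pq.2 else 0.

(** Von Neumann's lemma: unless two points of a column are sent to the same
    row, and the product vanishes, [x] is a product of a column and a row
    permutation. *)
Lemma col_row_factor x : b *m aG x *m a = factor_sign x *: (b *m a).
Proof.
rewrite /factor_sign; case: pickP => [[p q] /= /and3P[pR qC /eqP ->]|none].
  rewrite aGM !mulmxA col_sum_absorb // -!scalemxAl -mulmxA.
  by rewrite row_sum_absorb.
rewrite scale0r; case: (col_row_sum_cases mu mu x) => // sp.
have [p [q [pR qC ex]]] := spread_factor mu_n mu_part mu_n sp erefl.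
by have := none (p, q); rewrite /= pR qC ex eqxx.
Qed.

(** Transposition, which inverts group elements, fixes the row and column sums
    and exchanges the order of factors. *)
Lemma row_col_factor x : a *m aG x *m b = factor_sign x^-1%g *: c.
Proof.
apply: trmx_inj; rewrite linearZ /= young_mx_tr -col_row_factor.
by rewrite !trmx_mul row_sum_tr col_sum_tr aG_tr mulmxA.
Qed.

Lemma factor_sign_lin (f : 'S_n -> algC) :
  b *m (\sum_x f x *: aG x) *m a = (\sum_x f x * factor_sign x) *: (b *m a).
Proof.
rewrite mulmx_sandwich scaler_suml; apply: eq_bigr => x _.
by rewrite col_row_factor scalerA.
Qed.

(** The ratio of n! to the dimension of the Specht module. *)
Definition young_const : algC :=
  \sum_(q in col_stab n mu) \sum_(p in row_stab n mu)
    (-1) ^+ q * factor_sign (q * p)^-1%g.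

Lemma young_mx_sq : c *m c = young_const *: c.
Proof.
have ab : b *m a = \sum_(q in col_stab n mu) \sum_(p in row_stab n mu)
    (-1) ^+ q *: aG (q * p)%g.
  rewrite mulmx_suml; apply: eq_bigr => q _; rewrite -scalemxAl /row_sum mulmx_sumr.
  by rewrite scaler_sumr; apply: eq_bigr => p _; rewrite aGM.
rewrite /young_mx mulmxA -[a *m b *m a]mulmxA ab pair_big_dep /=.
rewrite mulmx_sandwich /young_const pair_big_dep scaler_suml.
by apply: eq_bigr => -[q p] _ /=; rewrite row_col_factor scalerA.
Qed.

End OneShape.
End YoungSymmetrizer.

(** * Specht characters *)

(** The diagonal entries of X X^T are sums of squares. *)
Lemma real_mx_gram_eq0 m (X : 'M[algC]_m) : (forall i j, X i j \is Num.real) ->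
  X *m X^T = 0 -> X = 0.
Proof.
move=> Xr XX; apply/matrixP => i j; rewrite mxE; apply/eqP.
have /matrixP/(_ i i) := XX; rewrite !mxE => /eqP.
under eq_bigr do rewrite mxE -expr2.
rewrite psumr_eq0 => [/allP/(_ j)|k _]; last by rewrite real_exprn_even_ge0.
by rewrite mem_index_enum sqrf_eq0 => /(_ isT).
Qed.

Lemma real_mxM m (X Y : 'M[algC]_m) : (forall i j, X i j \is Num.real) ->
  (forall i j, Y i j \is Num.real) -> forall i j, (X *m Y) i j \is Num.real.
Proof. by move=> Xr Yr i j; rewrite mxE rpred_sum // => k _; rewrite rpredM. Qed.

Section SpechtChar.
Variable n : nat.
Local Notation G := [set: 'S_n]%G.
Local Notation aG := (regular_repr algC G).
Local Notation E_G := (enveloping_algebra_mx aG).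
Local Notation order_G := (#|{: 'S_n}|%:R : algC).
Implicit Types (mu lam : seq nat) (x p q : 'S_n).

Lemma order_G_neq0 : order_G != 0.
Proof. by rewrite pnatr_eq0 -cardsT -lt0n cardG_gt0. Qed.

Definition young_coef mu x : algC :=
  \sum_(pq : 'S_n * 'S_n | (pq.1 \in row_stab n mu) && (pq.2 \in col_stab n mu))
    (-1) ^+ pq.2 *+ (pq.1 * pq.2 == x)%g.

Lemma young_mxE mu : young_mx n mu = \sum_x young_coef mu x *: aG x.
Proof.
under eq_bigr do rewrite /young_coef scaler_suml.
rewrite exchange_big /= /young_mx mulmx_suml.
transitivity (\sum_(p in row_stab n mu) \sum_(q in col_stab n mu)
   (-1) ^+ q *: aG (p * q)%g).
  apply: eq_bigr => p _; rewrite mulmx_sumr; apply: eq_bigr => q _.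
  by rewrite -scalemxAr aGM.
rewrite pair_big_dep; apply: eq_bigr => -[p q] _ /=.
rewrite (bigD1 (p * q)%g) //= eqxx mulr1n big1 ?addr0 // => x nx.
by rewrite eq_sym (negPf nx) mulr0n scale0r.
Qed.

Lemma young_mx_env mu : (young_mx n mu \in E_G)%MS.
Proof. by apply: envelop_mxM; [apply: row_sum_env | apply: col_sum_env]. Qed.

Lemma young_coef_int mu x : young_coef mu x \in Num.int.
Proof.
by apply: rpred_sum => pq _; apply: rpredMn; apply: rpredX; apply: rpredN1.
Qed.

Lemma young_mx_tr_coef mu x : \tr (young_mx n mu *m aG x^-1%g) = order_G * young_coef mu x.
Proof. by rewrite young_mxE mxtrace_coef. Qed.

Section OneShape.
Variable mu : seq nat.
Hypotheses (mu_part : is_partition mu) (mu_n : sumn mu = n).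
Local Notation a := (row_sum n mu).
Local Notation b := (col_sum n mu).
Local Notation c := (young_mx n mu).

(** A permutation that preserves both rows and columns is trivial. *)
Lemma young_coef1 : young_coef mu 1%g = 1.
Proof.
rewrite /young_coef (bigD1 (1%g, 1%g)) /=; last first.
  by rewrite (group1 (row_stab_group_struct n mu)) (group1 (col_stab_group_struct n mu)).
rewrite mulg1 eqxx mulr1n odd_perm1 expr0 big1 ?addr0 // => -[p q] /=.
case/andP=> /andP[pR qC] npq; case: eqP => [e|//]; case/eqP: npq.
have p1 : p = 1%g.
  apply/permP => i; rewrite perm1; apply: (cell_eq (mu := mu)).
    by have /row_stabP := pR.
  have -> : p = (q^-1)%g by rewrite -[p]mulg1 -(mulgV q) mulgA e mul1g.
  by have /col_stabP := groupVr (G := col_stab_group_struct n mu) qC.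
by move: e; rewrite p1 mul1g => ->.
Qed.

Lemma young_mx_neq0 : c != 0.
Proof.
apply: contraTneq (oner_neq0 algC) => c0; apply/negPn/eqP.
have := young_mx_tr_coef mu 1%g; rewrite c0 mul0mx mxtrace0 young_coef1 mulr1.
by move/esym/eqP; rewrite (negPf order_G_neq0).
Qed.

(** The Young symmetrizer c is a nonzero real matrix, hence so are c c^T and
    (c c^T)(c c^T)^T. But c c^T c is a multiple of c^2, since the row and column
    sums are idempotent up to scalars. *)
Lemma young_const_neq0 : young_const n mu != 0.
Proof.
apply/eqP => g0; have := young_mx_sq mu_part mu_n; rewrite g0 scale0r => cc.
have creal i j : c i j \is Num.real.
  rewrite young_mxE summxE rpred_sum // => x _; rewrite mxE rpredM //.
    exact/Rreal_int/young_coef_int.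
  by rewrite !mxE realn.
have ctreal i j : c^T i j \is Num.real by rewrite mxE.
have ctc : c *m c^T *m c = 0.
  rewrite young_mx_tr /young_mx !mulmxA -[a *m b *m b]mulmxA col_sum_sq.
  rewrite -scalemxAr -!scalemxAl -[_ *m a *m a]mulmxA row_sum_sq.
  by rewrite -scalemxAr -!scalemxAl -(mulmxA (a *m b)) -/(young_mx n mu) cc !scaler0.
have c_ct : c *m c^T = 0.
  apply: real_mx_gram_eq0; first exact: real_mxM.
  by rewrite (trmx_mul c c^T) trmxK mulmxA ctc mul0mx.
by have /eqP := young_mx_neq0; apply; apply: real_mx_gram_eq0.
Qed.

Lemma specht_charE x : specht_char n mu x =
  (young_const n mu * order_G)^-1 * \sum_y \tr (c *m aG (y * x * y^-1)%g).
Proof.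
rewrite /specht_char /specht_repr young_symmetrizerE.
apply: quasi_idempotent_char; first exact: young_mx_env.
  exact: young_const_neq0.
exact: young_mx_sq.
Qed.

Lemma specht_char_lin (f : 'S_n -> algC) (P : pred 'S_n) :
  \sum_(x | P x) f x * specht_char n mu x =
  (young_const n mu * order_G)^-1 *
    \sum_y \tr (c *m aG y *m (\sum_(x | P x) f x *: aG x) *m aG y^-1%g).
Proof.
under eq_bigr do rewrite specht_charE mulrCA.
rewrite -mulr_sumr; congr (_ * _).
under eq_bigr do rewrite mulr_sumr.
rewrite exchange_big; apply: eq_bigr => y _ /=.
rewrite mulmx_sandwich raddf_sum; apply: eq_bigr => x _ /=.
by rewrite mxtraceZ -!mulmxA -!aGM !mulgA.
Qed.

Lemma specht_char_char : specht_char n mu \is a character.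
Proof. exact: cfRepr_char. Qed.

(** Homomorphisms from the ideal generated by an idempotent e to a module are
    given by the image of e, so a multiplicity is a character value at e. *)
Lemma cfdot_specht (chi : 'CF(G)) : chi \is a character ->
  '[specht_char n mu, chi] =
  (young_const n mu)^-1 * \sum_x young_coef mu x * chi x.
Proof.
move=> chi_char; rewrite cfdotE cardsT.
have -> : \sum_(x in G) specht_char n mu x * (chi x)^* =
    (young_const n mu * order_G)^-1 *
      \sum_y \sum_x \tr (c *m aG (y * x * y^-1)%g) * chi x^-1%g.
  rewrite exchange_big mulr_sumr; apply: eq_big => [x|x _]; first by rewrite inE.
  by rewrite specht_charE -mulrA [X in _ * X = _]mulr_suml char_inv.
have inner y : \sum_x \tr (c *m aG (y * x * y^-1)%g) * chi x^-1%g =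
    order_G * \sum_x young_coef mu x * chi x.
  rewrite (reindex_inj (conjg_inj y)) /= (reindex_inj invg_inj) mulr_sumr.
  apply: eq_bigr => x _ /=.
  rewrite conjgE !mulgA mulgV mul1g mulgK young_mx_tr_coef -mulrA; congr (_ * (_ * _)).
  by rewrite !invMg !invgK -conjgE cfunJ ?inE.
rewrite (eq_bigr _ (fun y _ => inner y)) sumr_const -[X in _ *+ X]cardsT cardsT.
rewrite -mulr_natl; have := order_G_neq0; have := young_const_neq0.
set S := \sum_x _; set g := order_G; set gamma := young_const n mu => gam0 g0.
by field; apply/andP.
Qed.

End OneShape.
End SpechtChar.

(** * Orthogonality of the Specht characters *)

Section SpechtOrthogonality.
Variable n : nat.
Local Notation G := [set: 'S_n]%G.
Local Notation aG := (regular_repr algC G).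
Local Notation order_G := (#|{: 'S_n}|%:R : algC).
Implicit Types (mu lam : seq nat) (x p q : 'S_n).

Definition is_partition_of mu := is_partition mu && (sumn mu == n).

Lemma is_partition_ofP mu : is_partition_of mu -> is_partition mu /\ sumn mu = n.
Proof. by case/andP => ? /eqP. Qed.

Lemma col_young_row mu : is_partition mu -> sumn mu = n ->
  col_sum n mu *m young_mx n mu *m row_sum n mu =
  young_const n mu *: (col_sum n mu *m row_sum n mu).
Proof.
move=> pm nm; apply: trmx_inj; rewrite linearZ /= -young_mx_tr trmxK.
rewrite -young_mx_sq // [LHS]trmx_mul [X in _ *m X]trmx_mul young_mx_tr.
by rewrite row_sum_tr col_sum_tr /young_mx !mulmxA.
Qed.

Lemma col_row_neq0 mu : is_partition mu -> sumn mu = n ->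
  col_sum n mu *m row_sum n mu != 0.
Proof. by move=> pm nm; rewrite -young_mx_tr trmx_eq0 young_mx_neq0. Qed.

Lemma factor_sign_coef mu : is_partition_of mu ->
  \sum_(x : 'S_n) young_coef mu x * factor_sign mu x = young_const n mu.
Proof.
case/is_partition_ofP => pm nm.
have /eqP := factor_sign_lin pm nm (young_coef mu).
rewrite -young_mxE col_young_row // -subr_eq0 -scalerBl scaler_eq0 subr_eq0.
by rewrite (negPf (col_row_neq0 pm nm)) orbF => /eqP.
Qed.

Lemma specht_char_sum mu (S : {set 'S_n}) : is_partition_of mu ->
  \sum_(x in S) specht_char n mu x = (young_const n mu * order_G)^-1 *
    \sum_y \tr (young_mx n mu *m aG y *m (\sum_(x in S) aG x) *m aG y^-1%g).
Proof.
case/is_partition_ofP => pm nm.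
have := specht_char_lin pm nm (fun=> 1) (mem S).
under eq_bigr do rewrite mul1r.
by move=> ->; under [\sum_(x in S) aG x]eq_bigr do rewrite -[aG _]scale1r.
Qed.

Lemma specht_char_sum0 mu (S : {set 'S_n}) : is_partition_of mu ->
  (forall y, col_sum n mu *m aG y *m (\sum_(x in S) aG x) = 0) ->
  \sum_(x in S) specht_char n mu x = 0.
Proof.
move=> pm v; rewrite specht_char_sum // big1 ?mulr0 // => y _.
by rewrite /young_mx -!mulmxA (mulmxA (col_sum n mu)) (mulmxA _ _ (aG y^-1%g))
  v mul0mx mulmx0 mxtrace0.
Qed.

(** Up to the order of the stabilizer, this sum is the multiplicity of the
    character of [mu] in the permutation character on tabloids of shape [lam]. *)
Lemma specht_char_row_stab0 lam mu : is_partition_of lam -> is_partition_of mu ->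
  ~ dominated lam mu -> \sum_(p in row_stab n lam) specht_char n mu p = 0.
Proof.
move=> /is_partition_ofP[pl nl] /[dup] pm' /is_partition_ofP[pm nm] nd.
apply: specht_char_sum0 => // y; apply/eqP; apply/negPn/negP => nz.
by apply: nd; apply: col_row_sum_dominated nz.
Qed.

Lemma specht_char_row_stab mu : is_partition_of mu ->
  \sum_(p in row_stab n mu) specht_char n mu p = #|row_stab n mu|%:R.
Proof.
move=> /[dup] pm' /is_partition_ofP[pm nm].
rewrite specht_char_sum // -/(row_sum n mu).
set a := row_sum n mu; set b := col_sum n mu.
have env : (a *m b *m a \in enveloping_algebra_mx aG)%MS.
  by rewrite !envelop_mxM ?row_sum_env ?col_sum_env.
pose f x := \tr (a *m b *m a *m aG x^-1%g) / order_G.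
have fE : a *m b *m a = \sum_x f x *: aG x by apply: envelopP.
have e1 y : \tr (young_mx n mu *m aG y *m a *m aG y^-1%g) = f y * factor_sign mu y * order_G.
  rewrite /young_mx -/a -/b -!mulmxA (mulmxA b) (mulmxA (b *m _)) col_row_factor //.
  rewrite -scalemxAl -scalemxAr mxtraceZ !mulmxA.
  by rewrite /f mulrAC divfK ?order_G_neq0 // mulrC.
rewrite (eq_bigr _ (fun y _ => e1 y)) -mulr_suml.
have -> : \sum_y f y * factor_sign mu y = #|row_stab n mu|%:R * young_const n mu.
  have /eqP := factor_sign_lin pm nm f; rewrite -fE -/b -/a.
  have -> : b *m (a *m b *m a) *m a =
      (#|row_stab n mu|%:R * young_const n mu) *: (b *m a).
    rewrite -scalerA -[_ *: (b *m a)]col_young_row // /young_mx -/a -/b.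
    by rewrite -!mulmxA row_sum_sq -!scalemxAr.
  rewrite -subr_eq0 -scalerBl scaler_eq0 subr_eq0 (negPf (col_row_neq0 pm nm)).
  by rewrite orbF => /eqP.
have := order_G_neq0 n; have := young_const_neq0 pm nm.
set g := order_G; set gamma := young_const n mu => gam0 g0.
by field; apply/andP.
Qed.

Lemma specht_norm mu : is_partition_of mu ->
  '[specht_char n mu, specht_char n mu]_G = 1.
Proof.
move=> /[dup] pm' /is_partition_ofP[pm nm].
rewrite cfdot_specht ?specht_char_char // specht_char_lin // -young_mxE.
have e1 y : \tr (young_mx n mu *m aG y *m young_mx n mu *m aG y^-1%g) =
    young_coef mu y * factor_sign mu y * (young_const n mu * order_G).
  have -> : young_mx n mu *m aG y *m young_mx n mu =
      (factor_sign mu y * young_const n mu) *: young_mx n mu.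
    rewrite {1 2}/young_mx -!mulmxA (mulmxA (col_sum n mu)) (mulmxA (_ *m aG y)).
    rewrite col_row_factor // -scalemxAl -scalemxAr -!mulmxA (mulmxA (row_sum n mu)).
    by rewrite -/(young_mx n mu) young_mx_sq // scalerA.
  rewrite -scalemxAl mxtraceZ young_mx_tr_coef.
  by rewrite mulrACA [RHS]mulrACA [young_const n mu * _]mulrC; ring.
rewrite (eq_bigr _ (fun y _ => e1 y)) -mulr_suml factor_sign_coef //.
have := order_G_neq0 n; have := young_const_neq0 pm nm.
set g := order_G; set gamma := young_const n mu => gam0 g0.
by field; apply/andP.
Qed.

(** The character of [mu] at the Young symmetrizer of [lam] is a sum of traces
    with a factor col_sum mu * x * row_sum lam, which vanishes. *)
Lemma specht_orth0 lam mu : is_partition_of lam -> is_partition_of mu ->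
  ~ dominated lam mu -> '[specht_char n lam, specht_char n mu]_G = 0.
Proof.
move=> /is_partition_ofP[pl nl] /is_partition_ofP[pm nm] nd.
rewrite cfdot_specht ?specht_char_char // specht_char_lin // -young_mxE.
rewrite big1 ?mulr0 // => y _.
have -> : young_mx n mu *m aG y *m young_mx n lam = 0; last by rewrite mul0mx mxtrace0.
rewrite /young_mx -!mulmxA (mulmxA (col_sum n mu)) (mulmxA (_ *m aG y)).
have [->|nz] := eqVneq (col_sum n mu *m aG y *m row_sum n lam) 0.
  by rewrite mul0mx mulmx0.
by case: nd; apply: col_row_sum_dominated nz.
Qed.

Lemma specht_orth lam mu : is_partition_of lam -> is_partition_of mu ->
  '[specht_char n lam, specht_char n mu]_G = (lam == mu)%:R.
Proof.
move=> pl pm; case: eqVneq => [->|/eqP ne]; first exact: specht_norm.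
have [plp _] := is_partition_ofP pl; have [pmp _] := is_partition_ofP pm.
have [d1|d1] := boolP ('[specht_char n lam, specht_char n mu]_G == 0).
  exact/eqP.
have [d2|d2] := boolP ('[specht_char n mu, specht_char n lam]_G == 0).
  by rewrite cfdotC (eqP d2) conjC0.
have dec l m : is_partition_of l -> is_partition_of m ->
    '[specht_char n l, specht_char n m]_G != 0 -> dominated l m.
  move=> hl hm nz r; rewrite leqNgt; apply/negP => lt.
  case/eqP: nz; apply: specht_orth0 => // /(_ r).
  by rewrite leqNgt lt.
by case: ne; apply: dominated_anti => //; apply: dec.
Qed.

Lemma specht_char_rat mu x : is_partition_of mu -> specht_char n mu x \in Crat.
Proof.
case/is_partition_ofP => pm nm; rewrite specht_charE // rpredM //.
  rewrite rpredV rpredM ?rpred_nat // /young_const.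
  apply: rpred_sum => q _; apply: rpred_sum => p _; rewrite rpredM //.
    by rewrite rpredX // rpredN1.
  rewrite /factor_sign; case: pickP => [pq _|_]; last exact: rpred0.
  by rewrite rpredX // rpredN1.
apply: rpred_sum => y _; rewrite -(invgK (y * x * y^-1)%g).
rewrite young_mx_tr_coef rpredM ?rpred_nat //.
by apply: rpred_int_num; apply: young_coef_int.
Qed.

End SpechtOrthogonality.

(** * Completeness of the Specht characters *)

Definition partitions_of n : seq (seq nat) := [seq mu <- partitions_upto n | sumn mu == n].

Lemma mem_partitions_of n mu : (mu \in partitions_of n) = is_partition_of n mu.
Proof.
rewrite mem_filter mem_partitions_upto andbC /is_partition_of -andbA; congr (_ && _).
by apply: andb_idl => /eqP ->.
Qed.

Lemma uniq_partitions_of n : uniq (partitions_of n).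
Proof. exact/filter_uniq/uniq_partitions_upto. Qed.

Section Completeness.
Variable n : nat.
Local Notation G := [set: 'S_n]%G.

Definition cycle_type (pi : 'S_n) : seq nat :=
  sort geq [seq #|pred_of_set c| | c <- enum (porbits pi)].

Lemma cycle_type_partition pi : cycle_type pi \in partitions_of n.
Proof.
rewrite mem_partitions_of /is_partition_of /is_partition -andbA; apply/and3P; split.
- by apply: sort_sorted => x y; apply: leq_total.
- rewrite mem_sort; apply/mapP => -[c]; rewrite mem_enum => /imsetP[x _ ->] /eqP.
  by rewrite eq_sym (negPf (card_porbit_neq0 _ _)).
have /perm_sumn -> : perm_eq (cycle_type pi) [seq #|pred_of_set c| | c <- enum (porbits pi)].
  by rewrite perm_sort.
apply/eqP; rewrite sumnE big_map big_enum /= -[RHS]card_ord -sum1_card.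
rewrite (partition_big (porbit pi) (mem (porbits pi))) => [|x _]; last exact: imset_f.
apply: eq_bigr => c /imsetP[x _ ->]; rewrite sum1_card; apply: eq_card => y.
by rewrite -eq_porbit_mem.
Qed.

Lemma cycle_count_type pi i : cycle_count i pi = count_mem i (cycle_type pi).
Proof.
rewrite count_sort count_map /cycle_count cardE -size_filter.
rewrite /enum_mem -filter_predI; congr size; apply: eq_filter => c.
by rewrite !inE andbC.
Qed.

(** Permutations with the same cycle type are conjugate. *)
Lemma size_partitions_of : (#|classes G| <= size (partitions_of n))%N.
Proof.
pose ct (C : {set 'S_n}) := cycle_type (repr C).
have inj : {in classes G &, injective ct}.
  move=> C D /repr_classesP[_ eC] /repr_classesP[_ eD] e.
  rewrite eC eD; apply/class_eqP; apply: same_cycles_conjugate => i _.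
  by rewrite !cycle_count_type -/(ct D) -e.
rewrite cardE -(size_map ct); apply: uniq_leq_size.
  by rewrite map_inj_in_uniq ?enum_uniq // => C D; rewrite !mem_enum; apply: inj.
by move=> _ /mapP[C _ ->]; apply: cycle_type_partition.
Qed.

(** The Specht characters are irreducible, pairwise distinct, and at least as
    many as the conjugacy classes. *)
Lemma specht_irr_perm : perm_eq [seq specht_char n mu | mu <- partitions_of n] (irr G).
Proof.
have us : uniq [seq specht_char n mu | mu <- partitions_of n].
  rewrite map_inj_in_uniq ?uniq_partitions_of // => lam mu.
  rewrite !mem_partitions_of => pl pm e; apply/eqP.
  have /eqP := specht_orth pl pm; rewrite e specht_norm //.
  by case: (lam == mu) => //; rewrite oner_eq0.
have ui : uniq (irr G) by apply: free_uniq (irr_free G).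
have sub : {subset [seq specht_char n mu | mu <- partitions_of n] <= irr G}.
  move=> phi /mapP[mu]; rewrite mem_partitions_of => pm ->.
  by rewrite irrEchar specht_char_char specht_norm ?eqxx.
have [|_ eqi] := uniq_min_size us sub; last exact: uniq_perm.
by rewrite size_map size_tuple NirrE size_partitions_of.
Qed.

Lemma specht_expansion (phi : 'CF(G)) :
  phi = \sum_(mu <- partitions_of n) '[phi, specht_char n mu] *: specht_char n mu.
Proof.
rewrite {1}(cfun_sum_cfdot phi).
transitivity (\sum_(chi <- irr G) '[phi, chi] *: chi).
  by rewrite big_tuple.
by rewrite -(perm_big _ specht_irr_perm) big_map.
Qed.

End Completeness.

(** * Embedding counts as class functions *)

Lemma emb_conj (V : finType) (f : V -> V) n (pi tau : 'S_n) :
  emb f (pi ^ tau)%g = emb f pi.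
Proof.
pose push (phi : {ffun V -> 'I_n}) : {ffun V -> 'I_n} := [ffun v => tau (phi v)].
have inj : injective push.
  by move=> p q /ffunP e; apply/ffunP => v; have := e v; rewrite !ffunE => /perm_inj.
rewrite /emb -[RHS](card_imset _ inj); apply: eq_card => psi.
have pushE (phi : {ffun V -> 'I_n}) : (push phi \in embeddings f (pi ^ tau)%g) =
    (phi \in embeddings f pi).
  rewrite !inE; congr (_ && _).
    apply/injectiveP/injectiveP => h u v.
      by move=> e; apply: h; rewrite !ffunE e.
    by rewrite !ffunE => /perm_inj/h.
  by apply: eq_forallb => v; rewrite !ffunE conjgE !permM permK (inj_eq perm_inj).
apply/idP/imsetP => [h|[phi h ->]]; last by rewrite pushE.
have e : psi = push [ffun v => (tau^-1)%g (psi v)].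
  by apply/ffunP => v; rewrite !ffunE permKV.
by exists [ffun v => (tau^-1)%g (psi v)]; rewrite // -pushE -e.
Qed.

Section EmbCharacter.
Variables (V : finType) (f : V -> V) (n : nat).
Local Notation G := [set: 'S_n]%G.

Fact emb_cf_subproof : is_class_fun <<G>> [ffun x : 'S_n => (emb f x)%:R : algC].
Proof.
rewrite genGid; apply: intro_class_fun => [x y _ _|x]; last by rewrite inE.
by rewrite emb_conj.
Qed.
Definition emb_cf : 'CF(G) := Cfun 0 emb_cf_subproof.

Lemma emb_cfE pi : emb_cf pi = (emb f pi)%:R.
Proof. by rewrite cfunE. Qed.

Lemma cfdot_emb (chi : 'CF(G)) : '[emb_cf, chi] = (#|G|%:R)^-1 *
  \sum_(phi : {ffun V -> 'I_n} | injectiveb phi)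
    \sum_(pi : 'S_n | equivariant f pi phi) (chi pi)^*.
Proof.
rewrite cfdotE; congr (_ * _).
under eq_bigl do rewrite inE.
under eq_bigr do rewrite emb_cfE sum_embeddings mulr_suml.
rewrite exchange_big; apply: eq_bigr => phi _ /=; rewrite [RHS]big_mkcond.
apply: eq_bigr => pi _; rewrite -/(equivariant f pi phi).
by case: equivariant; rewrite ?mul1r ?mul0r.
Qed.

(** A permutation that carries [phi] to [psi] conjugates one set of indices to
    the other. *)
Lemma equivariant_conj (chi : 'CF(G)) (phi psi : {ffun V -> 'I_n}) :
  injective phi -> injective psi ->
  \sum_(pi : 'S_n | equivariant f pi phi) (chi pi)^* =
  \sum_(pi : 'S_n | equivariant f pi psi) (chi pi)^*.
Proof.
move=> ip iq; have [|alpha ha] := @perm_ext _ _ phi psi.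
  by move=> u v; rewrite !inj_eq.
rewrite [RHS](reindex_inj (conjg_inj alpha)); apply: eq_big => [pi|pi _]; last first.
  by rewrite cfunJ ?inE.
apply: eq_forallb => v; rewrite conjgE !permM -!ha permK.
by rewrite (inj_eq perm_inj).
Qed.

(** For a fixed injection phi, the permutations that induce [f] through phi form
    a set stable under the permutations of the n - |V| points outside the image
    of phi. These points are more than the columns of [mu], so two of them lie
    in the same column, and their transposition kills the sum. *)
Lemma emb_specht0 mu : is_partition_of n mu -> (nth 0 mu 0 < n - #|V|)%N ->
  '[emb_cf, specht_char n mu] = 0.
Proof.
move=> pm small; rewrite cfdot_emb big1 ?mulr0 // => phi /injectiveP inj.
rewrite -raddf_sum -[RHS](rmorph0 Num.conj); congr (_^*).
have -> : \sum_(pi | equivariant f pi phi) specht_char n mu pi =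
    \sum_(pi in [set pi | equivariant f pi phi]) specht_char n mu pi.
  by apply: eq_bigl => pi; rewrite inE.
apply: (specht_char_sum0 pm) => y.
have [pmu nmu] := is_partition_ofP pm.
pose D := [set i : 'I_n | y i \notin codom phi].
have cD : #|D| = (n - #|V|)%N.
  have -> : D = y @^-1: (~: [set z in codom phi]).
    by apply/setP => i; rewrite !inE.
  rewrite card_preimset; last exact: perm_inj.
  by rewrite cardsCs setCK card_ord cardsE card_codom.
have off_lt (i : 'I_n) : (reshape_offset mu i < nth 0 mu 0)%N.
  by apply: leq_trans (cell_bound nmu i) _; apply: partition_nth.
pose g (i : 'I_n) := Ordinal (off_lt i).
have /dinjectivePn[i iD [j]] : ~~ dinjectiveb g (mem D).
  apply/negP => /dinjectiveP/card_in_imset cim.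
  by have := max_card (mem (g @: D)); rewrite cim card_ord leqNgt cD small.
rewrite !inE => /andP[nji jD] [eij].
have nij : i != j by rewrite eq_sym.
apply: (col_sum_vanish nij eij) => s; rewrite !inE => /forallP eqv.
apply/forallP => v; rewrite permM tpermD; first exact: eqv.
  apply: contraNneq (_ : y i \notin codom phi) => [->|]; first exact: codom_f.
  by move: iD; rewrite !inE.
by apply: contraNneq jD => ->; rewrite codom_f.
Qed.

(** For an injection phi, the permutations that induce [f] through phi are as
    many as those that carry a fixed injection to phi, because each set is a
    translate of the pointwise stabilizer of an injection; and each permutation
    carries the fixed injection to exactly one phi. *)
Lemma sum_emb : injective f -> (#|V| <= n)%N ->
  (\sum_(pi : 'S_n) emb f pi)%N = n`!.
Proof.
move=> fi Vn.
have /card_gt0P[phi0 /=] : (0 < #|[set phi : {ffun V -> 'I_n} | injectiveb phi]|)%N.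
  by rewrite card_inj_ffuns card_ord ffact_gt0.
rewrite inE => /injectiveP i0.
have count (phi : {ffun V -> 'I_n}) : injective phi ->
   (\sum_(pi : 'S_n) equivariant f pi phi)%N =
   (\sum_(tau : 'S_n) ([ffun v => tau (phi0 v)] == phi))%N.
  move=> ip; have [|a ha] := @perm_ext _ _ phi0 phi; first by move=> u v; rewrite !inj_eq.
  have [|b hb] := @perm_ext _ _ phi0 (phi \o f).
    by move=> u v /=; rewrite !inj_eq.
  rewrite (reindex_inj (inj_comp (mulIg (a^-1 * b)%g) (mulgI a^-1%g))) /=.
  apply: eq_bigr => tau _; congr (nat_of_bool _).
  have E v : (a^-1 * tau * (a^-1 * b))%g (phi v) = b ((a^-1)%g (tau (phi0 v))).
    by rewrite -ha !permM permK.
  have hb' v : phi (f v) = b (phi0 v) by rewrite hb.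
  apply/forallP/eqP => [h|/ffunP h v].
    apply/ffunP => v; rewrite ffunE; have := h v; rewrite E hb' (inj_eq perm_inj).
    by move/eqP => e; rewrite -ha -[in RHS]e permKV.
  by have := h v; rewrite ffunE E hb' => ->; rewrite -ha permK.
rewrite (eq_bigr (fun pi : 'S_n => \sum_(phi : {ffun V -> 'I_n} | injectiveb phi)
    equivariant f pi phi)%N); last first.
  move=> pi _; rewrite /emb -sum1_card [LHS]big_mkcond [RHS]big_mkcond.
  by apply: eq_bigr => phi _; rewrite inE /equivariant; case: injectiveb; case: [forall v, _].
rewrite exchange_big /= (eq_bigr (fun phi => \sum_(tau : 'S_n)
    ([ffun v => tau (phi0 v)] == phi))%N); last by move=> phi /injectiveP /count.
rewrite exchange_big /= -[RHS](card_Sn n) -sum1_card; apply: eq_bigr => tau _.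
rewrite (bigD1 [ffun v => tau (phi0 v)]) /=; last first.
  by apply/injectiveP => u v; rewrite !ffunE => /perm_inj/i0.
by rewrite eqxx big1 // => phi /andP[_ ne]; rewrite eq_sym (negPf ne).
Qed.

End EmbCharacter.

(** * Inner products of embedding counts *)

Section Gram.
Variables (V W : finType) (f : V -> V) (g : W -> W).

Definition sum_map (x : V + W) : V + W :=
  match x with inl v => inl (f v) | inr w => inr (g w) end.

Definition injective_parts (R : eqType) (h : V + W -> R) : bool :=
  injectiveb (fun v => h (inl v)) && injectiveb (fun w => h (inr w)).

Lemma injective_parts_canon (R : eqType) (h : V + W -> R) :
  injective_parts (canon h) = injective_parts h.
Proof.
congr (_ && _); apply/injectiveP/injectiveP => inj u v /eqP e; apply: inj; apply/eqP.
- by rewrite canon_eq.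
- by rewrite -(canon_eq h).
- by rewrite canon_eq.
- by rewrite -(canon_eq h).
Qed.

(** A pair of embeddings is an equivariant map on the disjoint sum that is
    injective on both parts. Its kernel says how the two images overlap. *)
Lemma emb_mul n (pi : 'S_n) : (emb f pi * emb g pi)%N =
  (\sum_(c : {ffun V + W -> V + W} | (canon c == c) && injective_parts c)
     respects c sum_map * emb (quotient_map c sum_map) pi)%N.
Proof.
transitivity (\sum_(h : {ffun V + W -> 'I_n} | injective_parts h) equivariant sum_map pi h)%N.
  rewrite -cardsX -sum1_card [LHS]big_mkcond [RHS]big_mkcond /=.
  rewrite (reindex (fun p : {ffun V -> 'I_n} * {ffun W -> 'I_n} =>
     [ffun x => match x with inl v => p.1 v | inr w => p.2 w end] : {ffun V + W -> 'I_n})) /=;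
    last first.
    exists (fun h => ([ffun v => h (inl v)], [ffun w => h (inr w)])) => [[p q] _|h _].
      by congr (_, _); apply/ffunP => x; rewrite !ffunE.
    by apply/ffunP => -[v|w]; rewrite !ffunE.
  apply: eq_bigr => -[p q] _; set h := finfun _.
  have -> : injective_parts h = injectiveb p && injectiveb q.
    congr (_ && _); apply/injectiveP/injectiveP => inj u v e; apply: inj; move: e;
    by rewrite !ffunE.
  have -> : equivariant sum_map pi h =
      [forall v, pi (p v) == p (f v)] && [forall w, pi (q w) == q (g w)].
    apply/forallP/andP => [eqv|[/forallP ep /forallP eq] [v|w]]; last 2 first.
    - by rewrite !ffunE /=; apply: ep.
    - by rewrite !ffunE /=; apply: eq.
    split; apply/forallP => x; first by have := eqv (inl x); rewrite !ffunE.
    by have := eqv (inr x); rewrite !ffunE.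
  rewrite !inE /=.
  by case: injectiveb; case: injectiveb; case: [forall v, _]; case: [forall w, _].
rewrite (partition_big (fun h : {ffun V + W -> 'I_n} => canon h)
   (fun c => (canon c == c) && injective_parts c)) /=; last first.
  by move=> h ih; rewrite canon_canon eqxx injective_parts_canon.
apply: eq_bigr => c /andP[/eqP e ic]; rewrite -sum_equivariant_kernel //.
apply: eq_bigl => h; apply: andb_idl => /eqP hc.
by rewrite -injective_parts_canon hc.
Qed.

(** The number of ways in which the images of embeddings of [f] and of [g] can
    overlap. *)
Definition gram : nat :=
  \sum_(c : {ffun V + W -> V + W} | (canon c == c) && injective_parts c)
     respects c sum_map * injectiveb (quotient_map c sum_map).

(** Each overlap contributes the average of an embedding count, which is 1 as
    soon as the points suffice. *)
Lemma cfdot_emb_emb n : (#|V| + #|W| <= n)%N ->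
  '[emb_cf f n, emb_cf g n]_[set: 'S_n] = gram%:R.
Proof.
move=> le; rewrite cfdotE cardsT card_Sn.
have -> : \sum_(x in [set: 'S_n]) emb_cf f n x * (emb_cf g n x)^* =
    (\sum_(x : 'S_n) emb f x * emb g x)%N%:R.
  rewrite natr_sum; apply: eq_big => [x|x _]; first by rewrite inE.
  by rewrite !emb_cfE conjC_nat natrM.
under eq_bigr do rewrite emb_mul.
rewrite exchange_big /= (eq_bigr (fun c : {ffun V + W -> V + W} =>
   n`! * (respects c sum_map * injectiveb (quotient_map c sum_map)))%N).
  by rewrite -big_distrr /= natrM mulKf // pnatr_eq0 -lt0n fact_gt0.
move=> c _; rewrite -big_distrr mulnCA /=; congr (_ * _)%N.
have [/injectiveP inj|ni] := boolP (injectiveb (quotient_map c sum_map)).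
  rewrite muln1 sum_emb //; apply: leq_trans (card_classes_of c) _.
  by rewrite card_sum.
by rewrite big1 ?muln0 // => pi _; rewrite emb_noninj.
Qed.

End Gram.

(** * Row stabilizers of padded shapes *)

Lemma reshape_index_cons a s x : reshape_index (a :: s) x =
  if (x < a)%N then 0%N else (reshape_index s (x - a)).+1.
Proof.
rewrite /reshape_index /=; have [lt|ge] := ltnP x a.
  by have -> : (x.+1 - a)%N = 0%N by apply/eqP; rewrite subn_eq0.
by rewrite subSn //= -subSn.
Qed.

Section Pad.
Variables (n : nat) (la : seq nat).
Hypothesis la_n : (sumn la <= n)%N.
Local Notation m := (sumn la).
Local Notation G := [set: 'S_n].

(** The standard tableau of the padded shape has a first row of [n - m] points,
    below which the last [m] points form a tableau of shape [la]. *)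
Definition last_points : {ffun 'I_m -> 'I_n} :=
  [ffun i => cast_ord (subnK la_n) (rshift (n - m) i)].

Lemma last_points_inj : injective last_points.
Proof. by move=> i j; rewrite !ffunE => /cast_ord_inj/rshift_inj. Qed.

Lemma row_last_points i :
  reshape_index (pad_partition n la) (last_points i) = (reshape_index la i).+1.
Proof.
by rewrite reshape_index_cons ffunE /= ltnNge leq_addr /= addKn.
Qed.

Lemma last_pointsP (x : 'I_n) : (x < n - m)%N \/ exists i, x = last_points i.
Proof.
have [lt|ge] := ltnP x (n - m); [by left | right].
have xi : (x - (n - m) < m)%N by rewrite ltn_subLR // subnK.
by exists (Ordinal xi); apply: val_inj; rewrite ffunE /= subnKC.
Qed.

(** Permutations that preserve the rows of the padded shape induce on the last
    [m] points a permutation that preserves the rows of [la]. *)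
Lemma row_stab_pad (pi : 'S_n) :
  (\sum_(w in row_stab m la) equivariant w pi last_points)%N =
  (pi \in row_stab n (pad_partition n la)).
Proof.
have [/row_stabP piR|npi] := boolP (pi \in _).
  have ex i : {j | pi (last_points i) == last_points j}.
    apply/sigW; have := piR (last_points i); rewrite row_last_points.
    have [lt|[j ->]] := last_pointsP (pi (last_points i)); last by exists j.
    by rewrite reshape_index_cons lt.
  pose w i := sval (ex i).
  have wP i : pi (last_points i) = last_points (w i) by apply/eqP/(svalP (ex i)).
  have w_inj : injective w.
    by move=> i j e; apply/last_points_inj/(@perm_inj _ pi); rewrite !wP e.
  have wR : perm w_inj \in row_stab m la.
    apply/row_stabP => i; rewrite permE; apply: succn_inj.
    by rewrite -!row_last_points -wP piR.
  rewrite (bigD1 (perm w_inj)) //= big1 ?addn0 => [|u /andP[_ ne]].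
    by apply/eqP; rewrite eqb1; apply/forallP => i; rewrite permE wP.
  apply/eqP; rewrite eqb0; apply: contra ne => /forallP eqv.
  apply/eqP/permP => i; rewrite permE; apply: last_points_inj.
  by rewrite -wP (eqP (eqv i)).
rewrite big1 // => w /row_stabP wR; apply/eqP; rewrite eqb0.
apply: contra npi => /forallP eqv; apply/row_stabP => x.
have [lt|[i ->]] := last_pointsP x; last by rewrite (eqP (eqv i)) !row_last_points wR.
have [lt'|[j ej]] := last_pointsP (pi x); first by rewrite !reshape_index_cons lt lt'.
have : pi x = pi (last_points ((w^-1)%g j)) by rewrite (eqP (eqv _)) permKV.
move/perm_inj => ex; move: lt; rewrite ex ffunE /= ltnNge leq_addr.
by [].
Qed.

(** This is [#|row_stab m la|] times the permutation character on tabloids of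
    the padded shape. *)
Definition young_cf : 'CF(G) := \sum_(w in row_stab m la) emb_cf w n.

(** All injections of the last points are conjugate, which gives the formula up
    to a constant; the trivial character determines the constant. *)
Lemma cfdot_young (chi : 'CF(G)) : '[young_cf, chi] =
  #|row_stab m la|%:R / #|row_stab n (pad_partition n la)|%:R *
    \sum_(p in row_stab n (pad_partition n la)) (chi p)^*.
Proof.
pose inj_count : algC := #|[set phi : {ffun 'I_m -> 'I_n} | injectiveb phi]|%:R.
have E (xi : 'CF(G)) : '[young_cf, xi] = (#|G|%:R^-1 * inj_count) *
    \sum_(p in row_stab n (pad_partition n la)) (xi p)^*.
  rewrite cfdot_suml -mulrA.
  rewrite (eq_bigr (fun w : 'S_m => #|G|%:R^-1 * (inj_count *
    \sum_(pi : 'S_n | equivariant w pi last_points) (xi pi)^*))); last first.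
    move=> w _; rewrite cfdot_emb; congr (_ * _).
    rewrite (eq_bigr (fun=> \sum_(pi : 'S_n | equivariant w pi last_points) (xi pi)^*)).
      by rewrite sumr_const -mulr_natl /inj_count cardsE.
    move=> phi /injectiveP inj; apply: equivariant_conj => //.
    exact: last_points_inj.
  rewrite -!mulr_sumr; congr (_ * (_ * _)).
  under eq_bigr do rewrite big_mkcond.
  rewrite exchange_big [RHS]big_mkcond /=; apply: eq_bigr => pi _.
  have := row_stab_pad pi; case: (pi \in _) => e.
    rewrite -[RHS]mul1r -[1]/(true%:R) -e natr_sum mulr_suml; apply: eq_bigr => w _.
    by case: equivariant; rewrite ?mul1r ?mul0r.
  apply: big1 => w wR; case: ifP => // eq_w; move/eqP: e.
  by rewrite sum_nat_eq0 => /forall_inP/(_ w wR); rewrite eq_w.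
have := E 1; rewrite cfdot_suml.
rewrite (eq_bigr (fun=> 1)) => [|w _]; last first.
  have := cfdotE (emb_cf w n) (1 : 'CF(G)) => ->.
  rewrite cardsT card_Sn.
  have -> : \sum_(x in G) emb_cf w n x * ((1 : 'CF(G)) x)^* =
      (\sum_(x : 'S_n) emb w x)%N%:R.
    rewrite natr_sum; apply: eq_big => [x|x _]; first by rewrite inE.
    by rewrite emb_cfE cfun1E inE conjC1 mulr1.
  rewrite sum_emb ?card_ord //; last exact: perm_inj.
  by rewrite mulVf // pnatr_eq0 -lt0n fact_gt0.
rewrite sumr_const [in RHS](eq_bigr (fun=> 1)); last first.
  by move=> p _; rewrite cfun1E inE conjC1.
rewrite sumr_const => ->; rewrite (E chi) mulfK //.
by rewrite pnatr_eq0 -lt0n (cardG_gt0 (row_stab_group_struct n _)).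
Qed.

End Pad.

(** * Stable expansion in Specht characters *)

Section Stability.
Variable D : nat.
Hypothesis D_gt0 : (0 < D)%N.
Local Notation P := (partitions_upto D).
Local Notation X n la := (specht_char n (pad_partition n la)).

Lemma pad_partition_of n la : (2 * D <= n)%N -> la \in P ->
  is_partition_of n (pad_partition n la).
Proof.
move=> Dn; rewrite mem_partitions_upto => /andP[/andP[srt la0] laD].
rewrite /is_partition_of /is_partition /pad_partition inE negb_or la0 andbT /=.
rewrite subnK; last by lia.
rewrite eqxx andbT; apply/andP; split; last by apply/eqP; lia.
case: la srt la0 laD => //= x la -> _ le; rewrite andbT.
lia.
Qed.

Lemma pad_partition_inj n : injective (pad_partition n).
Proof. by move=> la mu [_ ->]. Qed.

Lemma behead_pad n mu : is_partition_of n mu -> (n - D <= nth 0 mu 0)%N -> (2 * D <= n)%N ->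
  behead mu \in P /\ mu = pad_partition n (behead mu).
Proof.
case/is_partition_ofP; case: mu => [|x la] /= pm nm le Dn.
  by move: nm le Dn; rewrite /=; lia.
move: pm; rewrite /is_partition /= inE negb_or => /andP[pth /andP[_ la0]].
rewrite mem_partitions_upto /is_partition (path_sorted pth) la0 /=.
split; first by move: le nm; rewrite /=; lia.
by rewrite /pad_partition -nm addnK.
Qed.

(** The other irreducible characters have a first row too short to occur. *)
Lemma emb_expansion n m (w : 'S_m) : (2 * D <= n)%N -> (m <= D)%N ->
  emb_cf w n = \sum_(la <- P) '[emb_cf w n, X n la] *: X n la.
Proof.
move=> Dn mD; rewrite {1}(specht_expansion (emb_cf w n)).
rewrite (bigID (fun mu : seq nat => n - D <= nth 0 mu 0)%N) /= addrC big1_seq ?add0r.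
  rewrite -big_filter.
  have pe : perm_eq [seq mu <- partitions_of n | (n - D <= nth 0 mu 0)%N]
      [seq pad_partition n la | la <- P].
    apply: uniq_perm.
    - exact/filter_uniq/uniq_partitions_of.
    - by rewrite (map_inj_uniq (@pad_partition_inj n)) uniq_partitions_upto.
    move=> mu; rewrite mem_filter mem_partitions_of; apply/andP/mapP.
      by case=> le /behead_pad/(_ le Dn)[bP ->]; exists (behead mu).
    case=> la laP ->; split; last exact: pad_partition_of.
    by move: laP; rewrite /= mem_partitions_upto => /andP[_]; lia.
  by rewrite (perm_big _ pe) big_map.
move=> mu /andP[]; rewrite -ltnNge mem_partitions_of => small pm.
rewrite emb_specht0 ?scale0r // card_ord; apply: leq_trans small _; lia.
Qed.

Lemma emb_specht_rat n m (w : 'S_m) la : (2 * D <= n)%N -> la \in P ->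
  '[emb_cf w n, X n la] \in Crat.
Proof.
move=> Dn laP; rewrite cfdotE rpredM ?rpredV ?rpred_nat //.
apply: rpred_sum => x _; rewrite emb_cfE rpredM ?rpred_nat //.
have r : X n la x \in Crat by apply: specht_char_rat; apply: pad_partition_of.
by rewrite conj_Crat.
Qed.

(** Padding turns the sums of initial rows into [n] minus the sums of the tails
    of the partition, so dominance of padded shapes lowers all tail sums. Their
    total is a measure for induction that does not involve [n]. *)
Definition tail_weight (la : seq nat) : nat := \sum_(r < D) sumn (drop r la).

Lemma size_le_sumn la : 0%N \notin la -> (size la <= sumn la)%N.
Proof.
elim: la => //= x la IH; rewrite inE negb_or eq_sym -lt0n => /andP[x0 /IH le].
by rewrite -add1n leq_add.
Qed.

Lemma dominated_pad n (la mu : seq nat) : (2 * D <= n)%N -> la \in P -> mu \in P ->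
  dominated (pad_partition n la) (pad_partition n mu) ->
  la = mu \/ (tail_weight mu < tail_weight la)%N.
Proof.
move=> Dn laP muP dom.
have tailE (nu : seq nat) r : nu \in P ->
    sumn (take r.+1 (pad_partition n nu)) = (n - sumn (drop r nu))%N.
  rewrite mem_partitions_upto => /andP[_ nuD] /=.
  have : (sumn nu = sumn (take r nu) + sumn (drop r nu))%N by rewrite -sumn_cat cat_take_drop.
  by move: (sumn nu) (sumn (take r nu)) (sumn (drop r nu)) nuD => s t u; lia.
have tail_le (nu : seq nat) r : nu \in P -> (sumn (drop r nu) <= D)%N.
  rewrite mem_partitions_upto => /andP[_]; apply: leq_trans.
  by rewrite -{2}(cat_take_drop r nu) sumn_cat leq_addl.
have le r : (sumn (drop r mu) <= sumn (drop r la))%N.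
  have := dom r.+1; rewrite !tailE //.
  move: (tail_le _ r laP) (tail_le _ r muP).
  by move: (sumn (drop r la)) (sumn (drop r mu)) => s t; lia.
have [lt|ge] := ltnP (tail_weight mu) (tail_weight la); [by right | left].
have eq_tail r : sumn (drop r mu) = sumn (drop r la).
  have [rD|Dr] := ltnP r D.
    apply: (@sum_eq_leq _ (fun r : 'I_D => sumn (drop r mu)) (fun r => sumn (drop r la))
       _ _ (Ordinal rD)) => [i|]; first exact: le.
    by apply/eqP; rewrite eqn_leq ge leq_sum.
  have drop_nil (nu : seq nat) : nu \in P -> drop r nu = [::].
    rewrite mem_partitions_upto => /andP[/andP[_ nu0] nuD]; apply: drop_oversize.
    exact: leq_trans (leq_trans (size_le_sumn nu0) nuD) Dr.
  by rewrite !drop_nil.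
apply: (@pad_partition_inj n).
have [pl _] := is_partition_ofP (pad_partition_of Dn laP).
have [pm _] := is_partition_ofP (pad_partition_of Dn muP).
apply: dominated_anti => // -[|r]; first by rewrite !take0.
by rewrite !tailE // eq_tail.
Qed.

(** Young's rule, as far as it is needed: the coefficient of the shape itself,
    and the vanishing of those that do not dominate it. *)
Lemma young_specht n la nu : (2 * D <= n)%N -> la \in P -> nu \in P ->
  '[young_cf n la, X n nu] = if la == nu then #|row_stab (sumn la) la|%:R
     else if (tail_weight nu < tail_weight la)%N then '[young_cf n la, X n nu] else 0.
Proof.
move=> Dn laP nuP.
have pl := pad_partition_of Dn laP; have pn := pad_partition_of Dn nuP.
have lan : (sumn la <= n)%N.
  by move: laP; rewrite mem_partitions_upto => /andP[_]; lia.
case: eqP => [<-|ne].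
  rewrite cfdot_young // -rmorph_sum specht_char_row_stab // rmorph_nat.
  rewrite divfK // pnatr_eq0 -lt0n.
  exact: (cardG_gt0 (row_stab_group_struct n _)).
case: ifP => // nlt; rewrite cfdot_young // -rmorph_sum specht_char_row_stab0 ?rmorph0 ?mulr0 //.
by case/(dominated_pad Dn laP nuP) => [//|]; rewrite nlt.
Qed.

(** Expanding [emb w] in the inner product with [young_cf la] expresses the
    coefficient of [emb w] at [la] by that inner product, which is a number of
    overlaps, and by coefficients at shapes of smaller tail weight. *)
Lemma emb_specht_stable la : la \in P ->
  forall m (w : 'S_m), (m <= D)%N -> forall n, (2 * D <= n)%N ->
  '[emb_cf w n, X n la] = '[emb_cf w (2 * D), X (2 * D) la].
Proof.
have [s] := ubnP (tail_weight la); elim: s => // s IHs in la * => lt_s laP m w mD n Dn.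
have laD : (sumn la <= D)%N by move: laP; rewrite mem_partitions_upto => /andP[].
pose c : algC := #|row_stab (sumn la) la|%:R.
have c0 : c != 0 by rewrite pnatr_eq0 -lt0n (cardG_gt0 (row_stab_group_struct _ _)).
have pairing N : (2 * D <= N)%N -> '[emb_cf w N, X N la] * c =
    '[emb_cf w N, young_cf N la] -
    \sum_(nu <- P | (nu != la) && (tail_weight nu < tail_weight la)%N)
       '[emb_cf w N, X N nu] * ('[young_cf N la, X N nu])^*.
  move=> DN; apply/eqP; rewrite eq_sym subr_eq; apply/eqP.
  rewrite {1}(emb_expansion w DN mD) cfdot_suml.
  rewrite (bigD1_seq la) ?uniq_partitions_upto //=; congr (_ + _).
    by rewrite cfdotZl cfdotC young_specht // eqxx conjC_nat.
  rewrite [LHS]big_seq_cond [RHS]big_seq_cond.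
  rewrite (bigID (fun nu => tail_weight nu < tail_weight la)%N) /=.
  rewrite addrC big1 ?add0r => [|nu /andP[/andP[nuP ne] nlt]]; last first.
    by rewrite cfdotZl cfdotC young_specht // eq_sym (negPf ne) (negPf nlt) rmorph0 mulr0.
  apply: eq_big => [nu|nu _]; first by rewrite andbA.
  by rewrite cfdotZl [Y in _ * Y = _]cfdotC.
have young_stable nu : nu \in P -> (tail_weight nu < tail_weight la)%N ->
    '[young_cf n la, X n nu] = '[young_cf (2 * D) la, X (2 * D) nu].
  move=> nuP lt; rewrite !cfdot_suml; apply: eq_bigr => u _.
  by apply: IHs => //; apply: leq_trans lt _.
apply: (mulIf c0); rewrite !pairing //; congr (_ - _).
  rewrite !cfdot_sumr; apply: eq_bigr => u _.
  by rewrite !cfdot_emb_emb // !card_ord; lia.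
rewrite [LHS]big_seq_cond [RHS]big_seq_cond; apply: eq_bigr => nu /and3P[nuP _ lt].
by rewrite young_stable // (IHs nu _ _ _ w) //; apply: leq_trans lt _.
Qed.

Lemma emb_specht_small n m (w : 'S_m) la : (2 * D <= n)%N -> la \in P ->
  (m < sumn la)%N -> '[emb_cf w n, X n la] = 0.
Proof.
move=> Dn laP lt; apply: emb_specht0; first exact: pad_partition_of.
by move: laP; rewrite card_ord /= mem_partitions_upto => /andP[_]; lia.
Qed.

(** On the generators the coefficients are constants, taken at the first stable
    size 2 * D; a factor [n] becomes a factor ['X]. *)
Lemma span_specht D' (F : forall n, 'S_n -> rat) : emb_span D' F -> (D' <= D)%N ->
  exists a : seq nat -> {poly rat},
    (forall la, a la != 0 -> (sumn la + size (a la) <= D'.+1)%N) /\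
    forall n, (2 * D <= n)%N -> forall pi : 'S_n,
      ratr (F n pi) = (\sum_(la <- P) ratr (a la).[n%:R] *: X n la) pi.
Proof.
elim=> {D' F} [m w|d F1 F2 _ IH1 _ IH2|d t F _ IH|d F _ IH|d d' F le _ IH|d F F' e _ IH] dD.
- exists (fun la => if (sumn la <= m)%N
      then (getCrat '[emb_cf w (2 * D), X (2 * D) la])%:P else 0); split.
    move=> la; case: ifP => [le _|_]; last by rewrite eqxx.
    by rewrite -[m.+1]addn1 leq_add // size_polyC_leq1.
  move=> n Dn pi; rewrite ratr_nat -emb_cfE {1}(emb_expansion w Dn dD).
  congr (fun_of_cfun _ pi); rewrite [LHS]big_seq [RHS]big_seq; apply: eq_bigr => la laP.
  congr (_ *: _); case: leqP => [_|lt]; last first.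
    by rewrite horner0 rmorph0 emb_specht_small.
  rewrite hornerC getCratK; last exact: emb_specht_rat.
  exact: emb_specht_stable.
- have [a1 [s1 e1]] := IH1 dD; have [a2 [s2 e2]] := IH2 dD.
  exists (fun la => a1 la + a2 la); split.
    move=> la nz; have := size_polyD (a1 la) (a2 la).
    have [z1|/s1 b1] := eqVneq (a1 la) 0; have [z2|/s2 b2] := eqVneq (a2 la) 0.
    - by case/eqP: nz; rewrite z1 z2 addr0.
    - by rewrite z1 add0r.
    - by rewrite z2 addr0.
    by move: b1 b2; lia.
  move=> n Dn pi; rewrite rmorphD /= e1 // e2 // !sum_cfunE -big_split /=.
  by apply: eq_bigr => la _; rewrite !cfunE hornerD rmorphD mulrDl.
- have [a [s1 e1]] := IH dD.
  exists (fun la => t *: a la); split.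
    move=> la nz; have : a la != 0 by apply: contraNneq nz => ->; rewrite scaler0.
    by move/s1; apply: leq_trans; rewrite leq_add2l size_scale_leq.
  move=> n Dn pi; rewrite rmorphM /= e1 // !sum_cfunE mulr_sumr.
  by apply: eq_bigr => la _; rewrite !cfunE hornerZ rmorphM mulrA.
- have [a [s1 e1]] := IH (ltnW dD).
  exists (fun la => 'X * a la); split.
    move=> la nz; have nza : a la != 0 by apply: contraNneq nz => ->; rewrite mulr0.
    by rewrite mulrC size_mulX // addnS ltnS s1.
  move=> n Dn pi; rewrite rmorphM /= e1 // !sum_cfunE mulr_sumr.
  by apply: eq_bigr => la _; rewrite !cfunE hornerM hornerX rmorphM mulrA.
- have [a [s1 e1]] := IH (leq_trans le dD).
  by exists a; split => // la /s1/leq_trans; apply.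
have [a [s1 e1]] := IH dD.
by exists a; split => // n Dn pi; rewrite -e e1.
Qed.

End Stability.

Theorem theorem1p1 (k d : nat) (hk : (1 <= k)%N) (hd : (1 <= d)%N)
    (sigma : 'S_k) :
  (exists f : {mpoly rat[(d * k).+1]},
     weighted_degree_le f (d * k) /\
     forall (n : nat), (1 <= n)%N -> forall pi : 'S_n,
       pattern_moment sigma d pi = f.@[cycle_point pi])
  /\
  (exists a : seq nat -> {poly rat},
     (forall la : seq nat, is_partition la -> (sumn la <= d * k)%N ->
        (size (a la) <= (d * k - sumn la).+1)%N) /\
     forall (n : nat), (2 * (d * k) <= n)%N -> forall pi : 'S_n,
       ratr (pattern_moment sigma d pi) =
       (\sum_(la <- partitions_upto (d * k))
          ratr (a la).[n%:R] *: specht_char n (pad_partition n la)) pi).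
Proof.
have in_span := span_pattern_moment d sigma; split.
  have [f [wf fE]] := cycle_poly_span in_span (leqnn _).
  by exists f; split => // n _ pi; apply: fE.
have dk0 : (0 < d * k)%N by rewrite muln_gt0 hd hk.
have [a [sa aE]] := span_specht dk0 in_span (leqnn _).
exists a; split => // la _ le; have [->|/sa] := eqVneq (a la) 0.
  by rewrite size_poly0.
by rewrite -subSn // leq_subRL ?(leq_trans le) // ltnW.
Qed.
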